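(* Let $p$ be a prime, $n\ge1$ an integer, $\alpha\in\mathbb{R}$, $0<q_1\leq q_2<\infty$, $1<r<\infty$, $\frac1r+\frac1{r'}=1$, and $b\in CMO^{\max\{r',r\}}(\mathbb{Q}_p^n)$. Then: (1) if $\alpha<\frac{n}{r'}$, then $\mathcal{H}^p_b$ is bounded from $K^{\alpha,q_1}_r(\mathbb{Q}_p^n)$ to $K^{\alpha,q_2}_r(\mathbb{Q}_p^n)$; (2) if $\alpha>-\frac{n}{r}$, then $\mathcal{H}^{p,*}_b$ is bounded from $K^{\alpha,q_1}_r(\mathbb{Q}_p^n)$ to $K^{\alpha,q_2}_r(\mathbb{Q}_p^n)$.
   Context: $\mathbb{Q}_p$ is the field of $p$-adic numbers with norm $|\cdot|_p$ normalized by $|p|_p=p^{-1}$; on $\mathbb{Q}_p^n$ one sets $|x|_p=\max_{1\le j\le n}|x_j|_p$. $dx$ is the Haar measure on $\mathbb{Q}_p^n$ normalized so that $\{x:|x|_p\le 1\}$ has measure $1$; $|E|_H$ is the Haar measure of $E$. For $k\in\mathbb{Z}$, $B_k=B_k(0)=\{x\in\mathbb{Q}_p^n:|x|_p\le p^k\}$, $S_k=B_k\setminus B_{k-1}$, and $\chi_k=\chi_{S_k}$ is the characteristic function of $S_k$. $B(0,|x|_p)=\{t\in\mathbb{Q}_p^n:|t|_p\le|x|_p\}$. The $p$-adic Hardy operators are, for $x\in\mathbb{Q}_p^n\setminus\{0\}$, $$\mathcal{H}^pf(x)=\frac{1}{|x|_p^n}\int_{B(0,|x|_p)}f(t)\,dt,\qquad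 \mathcal{H}^{p,*}f(x)=\int_{\mathbb{Q}_p^n\setminus B(0,|x|_p)}\frac{f(t)}{|t|_p^n}\,dt.$$ For a locally integrable $b$ on $\mathbb{Q}_p^n$, their commutators are $$\mathcal{H}^p_bf=b\,\mathcal{H}^pf-\mathcal{H}^p(bf),\qquad \mathcal{H}^{p,*}_bf=b\,\mathcal{H}^{p,*}f-\mathcal{H}^{p,*}(bf).$$ For $1\le s<\infty$, $CMO^s(\mathbb{Q}_p^n)$ is the set of $f\in L^s_{loc}(\mathbb{Q}_p^n)$ with $$\|f\|_{CMO^s(\mathbb{Q}_p^n)}=\sup_{\gamma\in\mathbb{Z}}\left(\frac{1}{|B_\gamma|_H}\int_{B_\gamma}|f(x)-f_{B_\gamma}|^s\,dx\right)^{1/s}<\infty,\qquad f_{B_\gamma}=\frac{1}{|B_\gamma|_H}\int_{B_\gamma}f(x)\,dx.$$ For $\alpha\in\mathbb{R}$, $0<q,r<\infty$, the homogeneous $p$-adic Herz space $K^{\alpha,q}_r(\mathbb{Q}_p^n)$ is the set of $f\in L^r_{loc}(\mathbb{Q}_p^n)$ with $$\|f\|_{K^{\alpha,q}_r(\mathbb{Q}_p^n)}=\left(\sum_{k=-\infty}^{+\infty}p^{k\alpha q}\|f\chi_k\|_{L^r(\mathbb{Q}_p^n)}^q\right)^{1/q}<\infty.$$ An operator $A$ is bounded from $X$ to $Y$ if there is a constant $C$ (independent of $f$) with $\|Af\|_Y\le C\|f\|_X$ for all $f\in X$. *)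

(* Defs.v *)
From HB Require Import structures.
From mathcomp Require Import all_boot all_order all_algebra.
From mathcomp Require Import generic_quotient ring_quotient.
From mathcomp Require Import all_classical all_reals all_analysis.
From mathcomp Require Import complex.
From mathcomp Require Import ring zify.

Set Implicit Arguments.
Unset Strict Implicit.
Unset Printing Implicit Defensive.

Import Order.TTheory GRing.Theory Num.Theory.

Local Open Scope ring_scope.
Local Open Scope classical_set_scope.
Local Open Scope quotient_scope.

(* The p-adic absolute value on the rationals: |p ^ k * a / b| = p ^ - k for
   a and b prime to p. *)
Definition rat_pnorm (p : nat) (x : rat) : rat :=
  if x == 0 then 0
  else p%:R ^ ((logn p `|denq x|)%:Z - (logn p `|numq x|)%:Z).

Section RatNorm.
Variables (p : nat) (p_pr : prime p).

Let p0 : (p%:R : rat) != 0.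
Proof. by rewrite pnatr_eq0 -lt0n prime_gt0. Qed.
Let pgt0 : 0 < (p%:R : rat).
Proof. by rewrite ltr0n prime_gt0. Qed.
Let pgt1 : 1 < (p%:R : rat).
Proof. by rewrite ltr1n prime_gt1. Qed.

Lemma rat_pnorm0 : rat_pnorm p 0 = 0.
Proof. by rewrite /rat_pnorm eqxx. Qed.

Lemma rat_pnorm_gt0 x : x != 0 -> 0 < rat_pnorm p x.
Proof. by rewrite /rat_pnorm => /negPf ->; rewrite exprz_gt0. Qed.

Lemma rat_pnorm_eq0 x : (rat_pnorm p x == 0) = (x == 0).
Proof.
case: (eqVneq x 0) => [->|x0]; first by rewrite rat_pnorm0 eqxx.
by rewrite gt_eqF// rat_pnorm_gt0.
Qed.

Lemma rat_pnorm_ge0 x : 0 <= rat_pnorm p x.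
Proof.
by case: (eqVneq x 0) => [->|/rat_pnorm_gt0/ltW//]; rewrite rat_pnorm0.
Qed.

Lemma rat_pnorm_div (m n : int) : m != 0 -> n != 0 ->
  rat_pnorm p (m%:~R / n%:~R) =
  p%:R ^ ((logn p `|n|)%:Z - (logn p `|m|)%:Z).
Proof.
move=> m0 n0; rewrite /rat_pnorm mulf_eq0 invr_eq0 !intr_eq0.
rewrite (negPf m0) (negPf n0) /=; set x := m%:~R / n%:~R.
have x0 : x != 0 by rewrite mulf_neq0 ?invr_eq0 ?intr_eq0.
have E : numq x * n = m * denq x.
  apply: (intr_inj (R := rat)); rewrite !rmorphM /=.
  have dx0 : (denq x)%:~R != 0 :> rat by rewrite intr_eq0 denq_neq0.
  have -> : (numq x)%:~R = x * (denq x)%:~R by rewrite -{2}(divq_num_den x) divfK.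
  by rewrite /x mulrAC divfK // intr_eq0.
have /(congr1 (fun z => logn p `|z|%N)) := E.
rewrite /= !abszM !lognM ?absz_gt0 ?denq_neq0 ?numq_eq0 // => F.
by congr (_ ^ _); lia.
Qed.

Lemma rat_pnormM x y : rat_pnorm p (x * y) = rat_pnorm p x * rat_pnorm p y.
Proof.
case: (eqVneq x 0) => [->|x0]; first by rewrite mul0r rat_pnorm0 mul0r.
case: (eqVneq y 0) => [->|y0]; first by rewrite mulr0 rat_pnorm0 mulr0.
have -> : x * y = (numq x * numq y)%:~R / (denq x * denq y)%:~R.
  by rewrite !rmorphM /= -{1}(divq_num_den x) -{1}(divq_num_den y) mulf_div.
rewrite rat_pnorm_div ?mulf_neq0 ?numq_eq0 ?denq_neq0 //.
rewrite /rat_pnorm (negPf x0) (negPf y0) -expfzDr //.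
rewrite !abszM !lognM ?absz_gt0 ?denq_neq0 ?numq_eq0 //.
by congr (_ ^ _); lia.
Qed.

Lemma rat_pnorm1 : rat_pnorm p 1 = 1.
Proof. by rewrite /rat_pnorm oner_eq0 /= logn1. Qed.

Lemma rat_pnormV x : rat_pnorm p x^-1 = (rat_pnorm p x)^-1.
Proof.
case: (eqVneq x 0) => [->|x0]; first by rewrite !(invr0, rat_pnorm0).
have nx0 : rat_pnorm p x != 0 by rewrite rat_pnorm_eq0.
by apply: (mulfI nx0); rewrite -rat_pnormM !mulfV // rat_pnorm1.
Qed.

Lemma rat_pnormN x : rat_pnorm p (- x) = rat_pnorm p x.
Proof. by rewrite /rat_pnorm oppr_eq0 denqN numqN abszN. Qed.

Lemma rat_pnormB x y : rat_pnorm p (x - y) = rat_pnorm p (y - x).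
Proof. by rewrite -opprB rat_pnormN. Qed.

Lemma rat_pnorm_p : rat_pnorm p p%:R = p%:R^-1.
Proof.
have := @rat_pnorm_div p%:Z 1; rewrite divr1 => -> //.
  by rewrite /= logn1 logn_prime // eqxx.
by rewrite eqz_nat -lt0n prime_gt0.
Qed.

Lemma rat_pnorm1D_le1 x : rat_pnorm p x <= 1 -> rat_pnorm p (1 + x) <= 1.
Proof.
case: (eqVneq x 0) => [->|x0]; first by rewrite addr0 rat_pnorm1.
case: (eqVneq (1 + x) 0) => [-> _|x1]; first by rewrite rat_pnorm0.
rewrite {1}/rat_pnorm (negPf x0) => le1.
have d0 : logn p `|denq x| = 0%N.
  apply/eqP; rewrite -leqn0 leqNgt; apply/negP => d0.
  have n0 : (0 < logn p `|numq x|)%N.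
    rewrite lt0n; apply/negP => /eqP n0; move: le1; rewrite n0 subr0.
    by rewrite -exprnP leNgt exprn_egt1 ?pgt1 // -lt0n d0.
  have := coprime_num_den x; rewrite /coprime => /eqP cop.
  have : (p %| gcdn `|numq x| `|denq x|)%N.
    move: d0 n0; rewrite !logn_gt0 => dp np.
    by move: dp np; rewrite dvdn_gcd !mem_primes => /and3P[_ _ pd] /and3P[_ _ ->].
  by rewrite cop dvdn1 => /eqP p1; move: p_pr; rewrite p1.
have dx0 : (denq x)%:~R != 0 :> rat by rewrite intr_eq0 denq_neq0.
have E : 1 + x = (denq x + numq x)%:~R / (denq x)%:~R.
  by rewrite rmorphD /= mulrDl divff // divq_num_den.
have m0 : denq x + numq x != 0.
  by apply: contraNneq x1; rewrite E => ->; rewrite mul0r.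
rewrite E rat_pnorm_div ?denq_neq0 // d0 sub0r -exprnN.
by rewrite invf_le1 ?exprn_gt0 // exprn_ege1 // ltW.
Qed.

Lemma rat_pnormD x y :
  rat_pnorm p (x + y) <= Num.max (rat_pnorm p x) (rat_pnorm p y).
Proof.
wlog le_yx : x y / rat_pnorm p y <= rat_pnorm p x => [H|].
  case/orP: (le_total (rat_pnorm p y) (rat_pnorm p x)) => /H //.
  by rewrite addrC maxC.
case: (eqVneq x 0) => [x0|x0].
  by move: le_yx; rewrite x0 add0r rat_pnorm0 le_max => ->.
rewrite le_max; apply/orP; left.
have -> : x + y = x * (1 + y / x) by rewrite mulrDr mulr1 mulrC divfK.
rewrite rat_pnormM ler_piMr ?rat_pnorm_ge0 // rat_pnorm1D_le1 //.
by rewrite rat_pnormM rat_pnormV ler_pdivrMr ?rat_pnorm_gt0 // mul1r.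
Qed.

Lemma rat_pnormD_lt x y e :
  rat_pnorm p x < e -> rat_pnorm p y < e -> rat_pnorm p (x + y) < e.
Proof. by move=> xe ye; rewrite (le_lt_trans (rat_pnormD _ _))// gt_max xe. Qed.

Lemma rat_pnormB_lt x y z e : rat_pnorm p (x - z) < e ->
  rat_pnorm p (z - y) < e -> rat_pnorm p (x - y) < e.
Proof. by move=> xz zy; rewrite -(subrKA z); exact: rat_pnormD_lt. Qed.

Lemma rat_pnorm_eq x y : rat_pnorm p (x - y) < rat_pnorm p y ->
  rat_pnorm p x = rat_pnorm p y.
Proof.
move=> xy; apply/eqP; rewrite eq_le; apply/andP; split.
  by rewrite -[x](subrK y) (le_trans (rat_pnormD _ _))// ge_max lexx ltW.
rewrite leNgt; apply/negP => lt_xy.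
suff : rat_pnorm p y < rat_pnorm p y by rewrite ltxx.
rewrite -{1}[y](subKr x); apply: rat_pnormD_lt => //.
by rewrite rat_pnormN.
Qed.

End RatNorm.

Definition padic_cauchy (p : nat) (u : nat -> rat) : Prop :=
  forall e : rat, 0 < e -> exists N, forall m n, (N <= m)%N -> (N <= n)%N ->
    rat_pnorm p (u m - u n) < e.

Definition padic_null (p : nat) (u : nat -> rat) : Prop :=
  forall e : rat, 0 < e -> exists N, forall n, (N <= n)%N ->
    rat_pnorm p (u n) < e.

Section CauchySequences.
Variables (p : nat) (p_pr : prime p).

Lemma padic_cauchy_cst c : padic_cauchy p (fun=> c).
Proof. by move=> e e0; exists 0%N => m n _ _; rewrite subrr rat_pnorm0. Qed.

Lemma padic_cauchyB u v : padic_cauchy p u -> padic_cauchy p v ->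
  padic_cauchy p (fun n => u n - v n).
Proof.
move=> cu cv e e0; have [N uN] := cu e e0; have [M vM] := cv e e0.
exists (maxn N M) => m n; rewrite !geq_max => /andP[Nm Mm] /andP[Nn Mn].
have -> : u m - v m - (u n - v n) = (u m - u n) - (v m - v n) by ring.
by apply: rat_pnormD_lt => //; rewrite ?rat_pnormN; [exact: uN|exact: vM].
Qed.

Lemma padic_cauchy_bounded u : padic_cauchy p u ->
  exists c, 0 < c /\ exists N, forall n, (N <= n)%N -> rat_pnorm p (u n) < c.
Proof.
move=> cu; have [N uN] := cu 1 ltr01.
have c0 : 0 < rat_pnorm p (u N) + 1.
  by rewrite ltr_wpDl ?ltr01 // rat_pnorm_ge0.
exists (rat_pnorm p (u N) + 1); split => //; exists N => n Nn.
rewrite -[u n](subrK (u N)); apply: rat_pnormD_lt => //; last by rewrite ltrDl.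
by rewrite (lt_le_trans (uN _ _ Nn (leqnn _))) // lerDr rat_pnorm_ge0.
Qed.

Lemma padic_cauchyM u v : padic_cauchy p u -> padic_cauchy p v ->
  padic_cauchy p (fun n => u n * v n).
Proof.
move=> cu cv e e0.
have [a [a0 [A uA]]] := padic_cauchy_bounded cu.
have [b [b0 [B vB]]] := padic_cauchy_bounded cv.
have [N uN] := cu (e / b) (divr_gt0 e0 b0).
have [M vM] := cv (e / a) (divr_gt0 e0 a0).
exists (maxn (maxn A B) (maxn N M)) => m n.
rewrite !geq_max => /andP[/andP[Am Bm] /andP[Nm Mm]].
move=> /andP[/andP[An Bn] /andP[Nn Mn]].
have -> : u m * v m - u n * v n = (u m - u n) * v m + u n * (v m - v n).
  by ring.
apply: rat_pnormD_lt => //; rewrite rat_pnormM //.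
- rewrite -(divfK (lt0r_neq0 b0) e).
  by rewrite ltr_pM ?rat_pnorm_ge0 //; [exact: uN|exact: vB].
- rewrite -(divfK (lt0r_neq0 a0) e) mulrC.
  by rewrite ltr_pM ?rat_pnorm_ge0 //; [exact: vM|exact: uA].
Qed.

Lemma padic_null_cauchy u : padic_null p u -> padic_cauchy p u.
Proof.
move=> nu e e0; have [N uN] := nu e e0; exists N => m n Nm Nn.
by apply: rat_pnormD_lt => //; rewrite ?rat_pnormN; exact: uN.
Qed.

Lemma padic_nullB u v : padic_null p u -> padic_null p v ->
  padic_null p (fun n => u n - v n).
Proof.
move=> nu nv e e0; have [N uN] := nu e e0; have [M vM] := nv e e0.
exists (maxn N M) => n; rewrite geq_max => /andP[Nn Mn].
by apply: rat_pnormD_lt => //; rewrite ?rat_pnormN; [exact: uN|exact: vM].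
Qed.

Lemma padic_nullM u v : padic_cauchy p u -> padic_null p v ->
  padic_null p (fun n => u n * v n).
Proof.
move=> cu nv e e0.
have [a [a0 [A uA]]] := padic_cauchy_bounded cu.
have [M vM] := nv (e / a) (divr_gt0 e0 a0).
exists (maxn A M) => n; rewrite geq_max => /andP[An Mn].
rewrite rat_pnormM // -(divfK (lt0r_neq0 a0) e) mulrC.
by rewrite ltr_pM ?rat_pnorm_ge0 //; [exact: vM|exact: uA].
Qed.

Lemma padic_null_dist u v : padic_null p (fun n => u n - v n) ->
  padic_null p u -> padic_null p v.
Proof.
move=> nuv nu; have := padic_nullB nu nuv.
by congr padic_null; apply/funext => n; rewrite subKr.
Qed.

Lemma padic_cauchy_stationary u : padic_cauchy p u -> ~ padic_null p u ->
  exists c, 0 < c /\ exists N, forall n, (N <= n)%N -> rat_pnorm p (u n) = c.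
Proof.
move=> cu; rewrite /padic_null => /existsNP[e /not_implyP[e0 /forallNP nu]].
have [N uN] := cu e e0.
have /existsNP[m /not_implyP[Nm /negP]] := nu N; rewrite -leNgt => em.
exists (rat_pnorm p (u m)); split; first exact: lt_le_trans em.
exists N => n Nn; apply: rat_pnorm_eq => //.
exact: lt_le_trans (uN _ _ Nn Nm) em.
Qed.

Lemma padic_cauchyV u : padic_cauchy p u -> ~ padic_null p u ->
  padic_cauchy p (fun n => (u n)^-1).
Proof.
move=> cu nu e e0; have [c [c0 [M uM]]] := padic_cauchy_stationary cu nu.
have [N uN] := cu (e * (c * c)) (mulr_gt0 e0 (mulr_gt0 c0 c0)).
exists (maxn N M) => m n; rewrite !geq_max => /andP[Nm Mm] /andP[Nn Mn].
have um0 : u m != 0 by rewrite -(rat_pnorm_eq0 p_pr) uM // gt_eqF.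
have un0 : u n != 0 by rewrite -(rat_pnorm_eq0 p_pr) uM // gt_eqF.
have -> : (u m)^-1 - (u n)^-1 = (u n - u m) / (u m * u n).
  by field; rewrite um0 un0.
rewrite rat_pnormM // rat_pnormV // rat_pnormM // !uM //.
by rewrite ltr_pdivrMr ?mulr_gt0 // uN.
Qed.

Definition padic_cauchyb (u : nat -> rat) : bool := `[< padic_cauchy p u >].

Lemma padic_cauchyb_subring : subring_closed padic_cauchyb.
Proof.
split=> [|u v /asboolP cu /asboolP cv|u v /asboolP cu /asboolP cv].
- by apply/asboolP; exact: padic_cauchy_cst.
- by apply/asboolP; exact: padic_cauchyB.
- by apply/asboolP; exact: padic_cauchyM.
Qed.

HB.instance Definition _ :=
  GRing.isSubringClosed.Build (nat -> rat) padic_cauchyb padic_cauchyb_subring.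

Record cauchy_seq_of (pr : prime p) := CauchySeq {
  cauchy_val :> nat -> rat;
  cauchy_valP : padic_cauchyb cauchy_val }.

Local Notation cauchy_seq := (cauchy_seq_of p_pr).

HB.instance Definition _ := [isSub of cauchy_seq for @cauchy_val p_pr].
HB.instance Definition _ := [Choice of cauchy_seq by <:].
HB.instance Definition _ :=
  [SubChoice_isSubComNzRing of cauchy_seq by <:].

Lemma cauchy_seqP (u : cauchy_seq) : padic_cauchy p u.
Proof. exact/asboolP/cauchy_valP. Qed.

Definition null_seq (u : cauchy_seq) : bool := `[< padic_null p u >].

Lemma null_seq_idealr : idealr_closed null_seq.
Proof.
split=> [||a u v /asboolP nu /asboolP nv].
- by apply/asboolP => e e0; exists 0%N => n _; rewrite rat_pnorm0.
- apply/asboolP => /(_ 1 ltr01)[N /(_ N (leqnn N))].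
  by rewrite rat_pnorm1 ltxx.
- apply/asboolP.
  have nN : padic_null p (fun n => 0 - v n).
    by apply: padic_nullB => // e e0; exists 0%N => n _; rewrite rat_pnorm0.
  have := padic_nullB (padic_nullM (cauchy_seqP a) nu) nN.
  by congr padic_null; apply/funext => n /=; rewrite sub0r opprK.
Qed.

HB.instance Definition _ := isIdealr.Build cauchy_seq null_seq null_seq_idealr.

(* The field of p-adic numbers, as the completion of the rationals for
   rat_pnorm: Cauchy sequences modulo null sequences. The lemmas below show
   that padic_norm is a multiplicative ultrametric norm extending rat_pnorm,
   for which the rationals are dense and padic is complete. *)
Definition padic : Type := Quotient.quot (null_seq : idealr cauchy_seq).

HB.instance Definition _ := GRing.ComNzRing.on padic.
HB.instance Definition _ := EqQuotient.on padic.

Lemma padic_pi_eq (u v : cauchy_seq) :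
  (\pi_padic u = \pi_padic v) <-> padic_null p (fun n => u n - v n).
Proof.
split=> [/eqP|uv]; first by rewrite -Quotient.idealrBE => /asboolP.
by apply/eqP; rewrite -Quotient.idealrBE; apply/asboolP.
Qed.

Lemma padic_piB (u v : cauchy_seq) :
  \pi_padic (u - v) = \pi_padic u - \pi_padic v.
Proof. by rewrite !piE. Qed.

Lemma padic_piM (u v : cauchy_seq) :
  \pi_padic (u * v) = \pi_padic u * \pi_padic v.
Proof. by rewrite !piE. Qed.

Lemma padic_pi0 : \pi_padic 0 = 0.
Proof. by rewrite !piE. Qed.

Lemma padic_pi1 : \pi_padic 1 = 1.
Proof. by rewrite !piE. Qed.

Lemma padic_pi_eq0 (u : cauchy_seq) : \pi_padic u = 0 <-> padic_null p u.
Proof.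
suff -> : padic_null p u = padic_null p (fun n => u n - 0).
  by rewrite -padic_pi0; exact: padic_pi_eq.
by congr padic_null; apply/funext => n /=; rewrite subr0.
Qed.

Lemma padic_inv_ex (x : padic) : x != 0 -> exists y, y * x = 1.
Proof.
elim/quotW: x => u /eqP /padic_pi_eq0 nu.
exists (\pi_padic (CauchySeq p_pr (asboolT (padic_cauchyV (@cauchy_seqP u) nu)))).
rewrite -padic_piM -padic_pi1; apply/padic_pi_eq => e e0.
have [c [c0 [N uN]]] := padic_cauchy_stationary (@cauchy_seqP u) nu.
exists N => n Nn.
rewrite [X in rat_pnorm p X](_ : _ = (u n)^-1 * u n - 1)//.
rewrite mulVf ?subrr ?rat_pnorm0 //.
by rewrite -(rat_pnorm_eq0 p_pr) uN // gt_eqF.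
Qed.

Definition padic_inv (x : padic) : padic :=
  if x == 0 then 0 else xget 0 [set y | y * x = 1].

Lemma padic_mulVf (x : padic) : x != 0 -> padic_inv x * x = 1.
Proof.
move=> x0; rewrite /padic_inv (negPf x0).
have [y yx] := padic_inv_ex x0; case: xgetP => [z _ //|/(_ y)].
by move/(_ yx).
Qed.

Lemma padic_inv0 : padic_inv 0 = 0.
Proof. by rewrite /padic_inv eqxx. Qed.

HB.instance Definition _ :=
  GRing.ComNzRing_isField.Build padic padic_mulVf padic_inv0.
HB.instance Definition _ := isPointed.Build padic 0.


(* If a p-adic Cauchy sequence u does not tend to 0 then |u n| is eventually
   constant, and its final value is the norm of the class of u. If u tends to 0
   then |u n| is either eventually equal to 0 or not eventually constant, hence
   the default value 0. *)
Definition padic_norm (x : padic) : rat :=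
  xget 0 [set c | exists N, forall n, (N <= n)%N ->
    rat_pnorm p ((repr x : cauchy_seq) n) = c].

Lemma padic_repr_null (x : padic) :
  padic_null p (repr x : cauchy_seq) <-> x = 0.
Proof. by rewrite -padic_pi_eq0 reprK. Qed.

Lemma padic_norm0 : padic_norm 0 = 0.
Proof.
rewrite /padic_norm; case: xgetP => // c _ [N uc]; apply/eqP.
rewrite eq_le; apply/andP; split; last first.
  by rewrite -(uc N) // rat_pnorm_ge0.
rewrite leNgt; apply/negP => c0.
have [M uM] := (padic_repr_null 0).2 erefl c c0.
have := uM _ (leq_maxr N M); by rewrite (uc _ (leq_maxl N M)) ltxx.
Qed.

Lemma padic_norm_repr (x : padic) : x != 0 -> exists N, forall n, (N <= n)%N ->
  rat_pnorm p ((repr x : cauchy_seq) n) = padic_norm x.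
Proof.
move=> /eqP x0; rewrite /padic_norm.
have [c [_ cP]] := padic_cauchy_stationary (@cauchy_seqP (repr x))
  (fun nu => x0 ((padic_repr_null x).1 nu)).
by case: xgetP => // /(_ c).
Qed.

Lemma padic_norm_pi (u : cauchy_seq) : ~ padic_null p u ->
  exists N, forall n, (N <= n)%N -> rat_pnorm p (u n) = padic_norm (\pi_padic u).
Proof.
move=> nu; set x := \pi_padic u.
have x0 : x != 0 by apply/eqP => /padic_pi_eq0.
have [N xN] := padic_norm_repr x0.
have [c [c0 [M uM]]] := padic_cauchy_stationary (@cauchy_seqP u) nu.
have /padic_pi_eq H : \pi_padic (repr x) = \pi_padic u by rewrite reprK.
have [K xK] := H c c0.
exists (maxn (maxn N M) K) => n; rewrite !geq_max => /andP[/andP[Nn Mn] Kn].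
by rewrite -(xN n Nn); apply/esym/rat_pnorm_eq => //; rewrite (uM n) // xK.
Qed.

Lemma padic_norm_gt0 x : x != 0 -> 0 < padic_norm x.
Proof.
elim/quotW: x => u /eqP u0; have nu : ~ padic_null p u by move/padic_pi_eq0.
have [N uN] := padic_norm_pi nu.
have [c [c0 [M uM]]] := padic_cauchy_stationary (@cauchy_seqP u) nu.
by rewrite -(uN _ (leq_maxl N M)) uM // leq_maxr.
Qed.

Lemma padic_norm_ge0 x : 0 <= padic_norm x.
Proof.
by case: (eqVneq x 0) => [->|/padic_norm_gt0/ltW//]; rewrite padic_norm0.
Qed.

Lemma padic_norm_eq0 x : (padic_norm x == 0) = (x == 0).
Proof.
case: (eqVneq x 0) => [->|x0]; first by rewrite padic_norm0 eqxx.
by rewrite gt_eqF // padic_norm_gt0.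
Qed.

Lemma padic_normM x y : padic_norm (x * y) = padic_norm x * padic_norm y.
Proof.
case: (eqVneq x 0) => [->|x0]; first by rewrite mul0r padic_norm0 mul0r.
case: (eqVneq y 0) => [->|y0]; first by rewrite mulr0 padic_norm0 mulr0.
have xy0 : x * y != 0 by rewrite mulf_neq0.
elim/quotW: x x0 xy0 => u u0; elim/quotW: y y0 => v v0 uv0.
have [N uN] := padic_norm_pi (fun nu => elimN eqP u0 ((padic_pi_eq0 u).2 nu)).
have [M vM] := padic_norm_pi (fun nu => elimN eqP v0 ((padic_pi_eq0 v).2 nu)).
rewrite -padic_piM in uv0 *.
have [K uvK] :=
  padic_norm_pi (fun nu => elimN eqP uv0 ((padic_pi_eq0 (u * v)).2 nu)).
rewrite -(uN (maxn (maxn N M) K)); last by rewrite -maxnA leq_maxl.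
rewrite -(vM (maxn (maxn N M) K)); last by rewrite -maxnA maxnCA leq_maxl.
by rewrite -(uvK (maxn (maxn N M) K)) ?leq_maxr // -rat_pnormM.
Qed.

Lemma padic_normD x y :
  padic_norm (x + y) <= Num.max (padic_norm x) (padic_norm y).
Proof.
case: (eqVneq x 0) => [->|x0]; first by rewrite add0r le_max lexx orbT.
case: (eqVneq y 0) => [->|y0]; first by rewrite addr0 le_max lexx.
case: (eqVneq (x + y) 0) => [->|xy0].
  by rewrite padic_norm0 le_max padic_norm_ge0.
elim/quotW: x x0 xy0 => u u0; elim/quotW: y y0 => v v0 uv0.
have [N uN] := padic_norm_pi (fun nu => elimN eqP u0 ((padic_pi_eq0 u).2 nu)).
have [M vM] := padic_norm_pi (fun nu => elimN eqP v0 ((padic_pi_eq0 v).2 nu)).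
have uvE : \pi_padic u + \pi_padic v = \pi_padic (u + v) by rewrite !piE.
rewrite uvE in uv0 *.
have [K uvK] :=
  padic_norm_pi (fun nu => elimN eqP uv0 ((padic_pi_eq0 (u + v)).2 nu)).
rewrite -(uN (maxn (maxn N M) K)); last by rewrite -maxnA leq_maxl.
rewrite -(vM (maxn (maxn N M) K)); last by rewrite -maxnA maxnCA leq_maxl.
by rewrite -(uvK (maxn (maxn N M) K)) ?leq_maxr // rat_pnormD.
Qed.

Definition padic_cst (q : rat) : cauchy_seq :=
  CauchySeq p_pr (asboolT (padic_cauchy_cst q)).

Definition padic_of_rat (q : rat) : padic := \pi_padic (padic_cst q).

Lemma padic_of_rat_is_zmod_morphism : zmod_morphism padic_of_rat.
Proof.
move=> a b; rewrite /padic_of_rat -padic_piB.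
by congr (\pi_padic _); apply/val_inj.
Qed.

Lemma padic_of_rat_is_monoid_morphism : monoid_morphism padic_of_rat.
Proof.
split=> [|a b]; rewrite /padic_of_rat -(padic_pi1, padic_piM);
  by congr (\pi_padic _); apply/val_inj.
Qed.

HB.instance Definition _ := GRing.isZmodMorphism.Build rat padic padic_of_rat
  padic_of_rat_is_zmod_morphism.
HB.instance Definition _ := GRing.isMonoidMorphism.Build rat padic padic_of_rat
  padic_of_rat_is_monoid_morphism.

Lemma padic_of_ratE q : padic_of_rat q = ratr q.
Proof. exact: fmorph_eq_rat. Qed.

Lemma padic_norm_rat q : padic_norm (padic_of_rat q) = rat_pnorm p q.
Proof.
case: (eqVneq q 0) => [->|q0].
  by rewrite rmorph0 padic_norm0 rat_pnorm0.
have nu : ~ padic_null p (padic_cst q).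
  move=> /padic_pi_eq0 h; move: q0; rewrite -(fmorph_eq0 padic_of_rat).
  by move=> /eqP; apply; exact: h.
by have [N /(_ N (leqnn N)) <-] := padic_norm_pi nu.
Qed.

Lemma padic_normN x : padic_norm (- x) = padic_norm x.
Proof.
have N1 : padic_norm (-1) = 1.
  by have := padic_norm_rat (-1); rewrite rmorphN1 rat_pnormN // rat_pnorm1.
by rewrite -mulN1r padic_normM N1 mul1r.
Qed.

Lemma padic_norm_piB_le (u : cauchy_seq) q e :
  (exists N, forall n, (N <= n)%N -> rat_pnorm p (u n - q) < e) ->
  0 < e -> padic_norm (\pi_padic u - padic_of_rat q) < e.
Proof.
move=> [N uN] e0.
case: (eqVneq (\pi_padic u - padic_of_rat q) 0) => [->|]; first by rewrite padic_norm0.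
rewrite -padic_piB => nu.
have [M uM] := padic_norm_pi (fun h => elimN eqP nu ((padic_pi_eq0 _).2 h)).
by rewrite -(uM _ (leq_maxr N M)); apply: uN; rewrite leq_maxl.
Qed.

Lemma padic_dense x e : 0 < e -> exists q : rat, padic_norm (x - padic_of_rat q) < e.
Proof.
elim/quotW: x => u e0; have [N uN] := @cauchy_seqP u e e0.
exists (u N); apply: padic_norm_piB_le => //.
by exists N => n Nn; exact: uN.
Qed.

Lemma padic_complete (x : nat -> padic) :
  (forall e : rat, 0 < e -> exists N, forall m n, (N <= m)%N -> (N <= n)%N ->
    padic_norm (x m - x n) < e) ->
  exists l, forall e : rat, 0 < e -> exists N, forall n, (N <= n)%N ->
    padic_norm (x n - l) < e.
Proof.
move=> cx.
have normD_lt a b e : padic_norm a < e -> padic_norm b < e ->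
    padic_norm (a + b) < e.
  by move=> ae be; rewrite (le_lt_trans (padic_normD _ _)) // gt_max ae.
have /choice[q qP] : forall k : nat, exists q, padic_norm (x k - padic_of_rat q) < k.+1%:R^-1.
  by move=> k; apply: padic_dense; rewrite invr_gt0.
have inv_small (e : rat) : 0 < e ->
    exists N, forall n, (N <= n)%N -> n.+1%:R^-1 < e.
  move=> e0; exists (Num.truncn e^-1) => n Nn.
  rewrite invf_plt ?posrE // (lt_le_trans (truncnS_gt _)) //.
  by rewrite ler_nat ltnS.
have cq : padic_cauchy p q.
  move=> e e0; have [N xN] := cx e e0; have [M iM] := inv_small e e0.
  exists (maxn N M) => m n; rewrite !geq_max => /andP[Nm Mm] /andP[Nn Mn].
  rewrite -padic_norm_rat rmorphB /=.
  have -> : padic_of_rat (q m) - padic_of_rat (q n) =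
      - (x m - padic_of_rat (q m)) + ((x m - x n) + (x n - padic_of_rat (q n))) by ring.
  apply: (normD_lt _ _ e); first by rewrite padic_normN (lt_trans (qP m)) ?iM.
  by apply: (normD_lt _ _ e); rewrite ?xN // (lt_trans (qP n)) ?iM.
exists (\pi_padic (CauchySeq p_pr (asboolT cq))) => e e0.
have [N qN] := cq e e0; have [M iM] := inv_small e e0.
exists (maxn N M) => n; rewrite !geq_max => /andP[Nn Mn].
rewrite -(subrKA (padic_of_rat (q n))); apply: normD_lt.
  by rewrite (lt_trans (qP n)) ?iM.
rewrite -opprB padic_normN; apply: padic_norm_piB_le => //.
by exists N => m Nm; exact: qN.
Qed.

End CauchySequences.

Section PadicSpace.
Variables (p : nat) (p_pr : prime p) (n : nat).
Local Notation vec := 'rV[padic p_pr]_n.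

Definition pnorm (x : vec) : rat :=
  \big[Num.max/0]_(j < n) padic_norm (x ord0 j).

Definition pball_at (a : vec) (k : int) : set vec :=
  [set x | pnorm (x - a) <= p%:R ^ k].

Definition padic_open : set (set vec) :=
  [set U | forall a, U a -> exists k : int, pball_at a k `<=` U].

(* Q_p^n with its Borel sigma-algebra. *)
Definition padic_space := g_sigma_algebraType padic_open.

Definition pball (k : int) : set padic_space :=
  [set x | pnorm x <= p%:R ^ k].

Definition psphere (k : int) : set padic_space := pball k `\` pball (k - 1).

Definition pball_of (x : padic_space) : set padic_space :=
  [set t | pnorm t <= pnorm x].

End PadicSpace.

Arguments pball {p} p_pr n k.
Arguments psphere {p} p_pr n k.

Local Open Scope complex_scope.

Section Functions.
Variables (R : realType) (p : nat) (p_pr : prime p) (n : nat).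
Local Notation T := (padic_space p_pr n).
Variable mu : {measure set T -> \bar R}.

(* Translation invariance and the normalization on the unit ball determine the
   measure on Borel sets. *)
Definition haar_measure : Prop :=
  mu (pball p_pr n 0) = 1%E /\
  forall (a : 'rV[padic p_pr]_n) (A : set T), measurable A ->
    mu [set a + x | x in A] = mu A.

(* Functions are complex-valued. They are measurable, integrable and integrated
   componentwise. *)
Definition cmod (z : R[i]) : R := Normc.normc z.

Definition cmeasurable (f : T -> R[i]) : Prop :=
  measurable_fun [set: T] (fun x => complex.Re (f x)) /\
  measurable_fun [set: T] (fun x => complex.Im (f x)).

Definition cintegrable (D : set T) (f : T -> R[i]) : Prop :=
  mu.-integrable D (fun x => (complex.Re (f x))%:E) /\
  mu.-integrable D (fun x => (complex.Im (f x))%:E).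

Definition cintegral (D : set T) (f : T -> R[i]) : R[i] :=
  (\int[mu]_(x in D) complex.Re (f x))%R +i*
  (\int[mu]_(x in D) complex.Im (f x))%R.

Definition Lr_norm (r : R) (f : T -> R[i]) : \bar R :=
  ('N[mu]_(r%:E)[EFin \o cmod \o f])%E.

(* Every compact subset of Q_p^n is contained in some ball B_k, and these balls
   are compact. *)
Definition Lr_loc (r : R) (f : T -> R[i]) : Prop :=
  cmeasurable f /\
  forall k : int, (\int[mu]_(x in pball p_pr n k) (cmod (f x) `^ r)%:E < +oo)%E.

Definition paverage (f : T -> R[i]) (k : int) : R[i] :=
  ((fine (mu (pball p_pr n k)))^-1)%:C * cintegral (pball p_pr n k) f.

Definition CMO_norm (s : R) (f : T -> R[i]) : \bar R :=
  (ereal_sup (range (fun k : int =>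
    ((fine (mu (pball p_pr n k)))^-1%:E *
     \int[mu]_(x in pball p_pr n k) (cmod (f x - paverage f k)%R `^ s)%:E)
    `^ s^-1)))%E.

Definition CMO (s : R) (f : T -> R[i]) : Prop :=
  Lr_loc s f /\ (CMO_norm s f < +oo)%E.

Definition herz_norm (alpha q r : R) (f : T -> R[i]) : \bar R :=
  ((\esum_(k in [set: int])
     ((p%:R `^ (k%:~R * alpha * q))%:E *
      Lr_norm r (fun x => f x * (\1_(psphere p_pr n k) x)%:C)%R `^ q))
   `^ q^-1)%E.

Definition herz (alpha q r : R) (f : T -> R[i]) : Prop :=
  Lr_loc r f /\ (herz_norm alpha q r f < +oo)%E.

Definition pnormn (x : T) : R := (ratr (pnorm x)) ^+ n.

(* The Hardy operators are only meaningful at x != 0. Their values at the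
   origin, a null set, are irrelevant to the norms above. *)
Definition hardy (f : T -> R[i]) (x : T) : R[i] :=
  (pnormn x)^-1%:C * cintegral (pball_of x) f.

Definition hardy_star (f : T -> R[i]) (x : T) : R[i] :=
  cintegral (~` pball_of x) (fun t => f t / (pnormn t)%:C).

(* Absolute convergence of the integrals defining hardy f and hardy_star f *)
Definition hardy_defined (f : T -> R[i]) : Prop :=
  forall x : T, x != 0 -> cintegrable (pball_of x) f.

Definition hardy_star_defined (f : T -> R[i]) : Prop :=
  forall x : T, x != 0 ->
    cintegrable (~` pball_of x) (fun t => f t / (pnormn t)%:C).

Definition commutator (A : (T -> R[i]) -> T -> R[i]) (b f : T -> R[i]) (x : T)
  : R[i] := b x * A f x - A (fun t => b t * f t) x.

Definition commutator_defined (dom : (T -> R[i]) -> Prop) (b f : T -> R[i])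
  : Prop := dom f /\ dom (fun t => b t * f t).

(* A, given by integrals that converge for the functions in dom, is a
   well-defined bounded operator from K^{alpha,q1}_r to K^{alpha,q2}_r. *)
Definition herz_bounded (alpha q1 q2 r : R) (dom : (T -> R[i]) -> Prop)
    (A : (T -> R[i]) -> T -> R[i]) : Prop :=
  exists C : R, forall f, herz alpha q1 r f ->
    [/\ dom f, herz alpha q2 r (A f) &
        (herz_norm alpha q2 r (A f) <= C%:E * herz_norm alpha q1 r f)%E].

End Functions.

(* Main.v *)
(* Both Hardy operators integrate f against a radial kernel K(|x|, |t|), and the
   commutator does not change when a constant is subtracted from b. On the
   sphere S_k take this constant to be the mean of b over B_k. Since the means
   over consecutive balls differ by a bounded amount, b minus the mean over B_k
   has normalized L^u norm O(1 + |k - j|) on S_j for u = r, r', so Hölder's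
   inequality on each sphere gives
     ||A_b f||_{L^r(S_k)} <=
       C sum_j (1 + |k - j|) p^(kn/r) K(k, j) p^(jn/r') ||f||_{L^r(S_j)}.
   The condition on alpha says that, after multiplication by p^(k alpha), the
   coefficients decay geometrically in |k - j|; the sum is then a convolution
   bounded on l^q for every q > 0, and l^q1 embeds in l^q2. Local L^r
   integrability of A_b f follows from the same estimate for a weight which is
   constant near the origin. *)
Require Import Defs.
From HB Require Import structures.
From mathcomp Require Import all_boot all_order all_algebra.
From mathcomp Require Import generic_quotient finmap.
From mathcomp Require Import all_classical all_reals all_analysis.
From mathcomp Require Import complex measurable_realfun.
From mathcomp Require Import ring lra zify.

Set Implicit Arguments.
Unset Strict Implicit.
Unset Printing Implicit Defensive.

Import Order.TTheory GRing.Theory Num.Theory.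
Local Open Scope ring_scope.
Local Open Scope classical_set_scope.

(** * Weighted sums over the integers *)

Section Discrete.
Context {R : realType}.
Local Open Scope ereal_scope.

(** Boundedness has three components: convergence of the integrals defining the operator at f and at
    b f, local L^r integrability of the image, and the norm inequality. The last does not contain
    the other two: for alpha > 0 the Herz weights tend to 0 at the origin, and the commutator is
    written with b itself, so a constant can be subtracted from b only once both integrals are known
    to converge. The proof therefore estimates one positive majorant, the kernel integral of (1 + |b
    - b_k|) |f| with b_k the mean over B_k. The summand 1 makes it dominate f as well as (b - b_k)
    f; its finiteness gives all the convergence, and its size the norms. For local integrability the
    Herz weight is replaced by p^(a0 max(k,0)) and the exponent q by r, because the r-th powers of
    the L^r norms on spheres add up to an integral. Here a0 must lie below alpha and not above 0
    and, for the dual operator, above -n/r. *)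

Lemma esum_mull_le (T : choiceType) (I : set T) (c : \bar R) (a : T -> \bar R) :
  0 <= c -> (forall i, I i -> 0 <= a i) ->
  \esum_(i in I) (c * a i) <= c * \esum_(i in I) a i.
Proof.
move=> c0 a0; apply: ge_ereal_sup => _ [X [finX XI] <-].
rewrite fsbig_finite//= big_seq -ge0_sume_distrr; last first.
  by move=> i; rewrite in_fset_set// inE => /XI/a0.
rewrite -big_seq -fsbig_finite//; apply: lee_wpmul2l => //.
by apply: ereal_sup_ubound; exists X.
Qed.

Lemma esum_exchange (T T' : choiceType) (a : T -> T' -> \bar R) :
  (forall i j, 0 <= a i j) ->
  \esum_(i in [set: T]) \esum_(j in [set: T']) a i j =
  \esum_(j in [set: T']) \esum_(i in [set: T]) a i j.
Proof.
move=> a0; rewrite !esum_esum//.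
rewrite (@reindex_esum _ _ _ ([set: T'] `*`` (fun=> [set: T])) _
  (fun z => (z.2, z.1)))//=.
split => //=.
- by move=> [x y] [x' y'] _ _ /= [-> ->].
- by move=> [x y] _; exists (y, x).
Qed.

Lemma esum_term_le (T : choiceType) (a : T -> \bar R) (i : T) :
  a i <= \esum_(j in [set: T]) a j.
Proof.
apply: esum_ge; exists [set i]; last by rewrite fsbig_set1.
by split => //; exact: finite_set1.
Qed.

Lemma esum_nat_geometric (t : R) : (0 < t < 1)%R ->
  \esum_(k in [set: nat]) (t ^+ k)%:E <= ((1 - t)^-1)%:E.
Proof.
move=> /andP[t0 t1]; rewrite -nneseries_esumT; last first.
  by move=> k; rewrite lee_fin exprn_ge0// ltW.
apply: lime_le.
  by apply: is_cvg_nneseries => k _ _; rewrite lee_fin exprn_ge0// ltW.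
apply: nearW => k; rewrite sumEFin lee_fin -[leRHS]mul1r ler_pdivlMr ?subr_gt0//.
rewrite big_mkord mulrC -opprB mulNr -subrX1 opprB gerBl.
by rewrite exprn_ge0// ltW.
Qed.

Lemma esum_int_geometric (t : R) : (0 < t < 1)%R ->
  \esum_(k in [set: int]) (t ^+ `|k|%N)%:E <= (2 / (1 - t))%:E.
Proof.
move=> t01; have /andP[t0 t1] := t01.
have p0 (m : nat) : 0 <= (t ^+ m)%:E by rewrite lee_fin exprn_ge0// ltW.
rewrite (esumID (range Posz))//.
have -> : [set: int] `&` ~` range Posz = range Negz.
  apply/seteqP; split => [[k|k] [_ /=]|_ [k _ <-]].
  - by move=> H; exfalso; apply: H; exists k.
  - by move=> _; exists k.
  - by split => // -[].
rewrite setTI !esum_image; [|by move=> i j _ _ []|by move=> i j _ _ []].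
rewrite mulrDl !mul1r EFinD leeD//; first exact: esum_nat_geometric.
(* [Negz k] has absolute value [k.+1], and t^(k+1) <= t^k. *)
apply: le_trans (esum_nat_geometric t01); apply: le_esum => k _ /=.
by rewrite lee_fin exprS ler_piMl ?exprn_ge0// ltW.
Qed.

Lemma esum_int_shift (a : int -> \bar R) (k : int) :
  \esum_(j in [set: int]) a (k - j)%R = \esum_(j in [set: int]) a j.
Proof.
apply/esym/reindex_esum; split => //.
- by move=> i j _ _ /addrI/oppr_inj.
- by move=> j _; exists (k - j)%R => //; rewrite subKr.
Qed.

Lemma le_poweR (x y : \bar R) (q : R) :
  (0 <= q)%R -> 0 <= x -> x <= y -> x `^ q <= y `^ q.
Proof.
move=> q0 x0 xy; apply: gt0_ler_poweR => //.
- by rewrite in_itv/= x0 leey.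
- by rewrite in_itv/= (le_trans x0 xy) leey.
Qed.

(* Splitting [t = s * s] bounds the inner sum by a supremum times a geometric
   series, and the [q]-th power of a supremum by a sum of [q]-th powers. This
   covers [q < 1] and [q >= 1] at once. *)
Lemma esum_geometric_convolution (t q : R) : (0 < t < 1)%R -> (0 < q)%R ->
  exists C : R, (0 <= C)%R /\ forall u : int -> \bar R, (forall j, 0 <= u j) ->
    \esum_(k in [set: int])
      (\esum_(j in [set: int]) ((t ^+ `|k - j|%N)%:E * u j)) `^ q <=
    C%:E * \esum_(j in [set: int]) u j `^ q.
Proof.
move=> /andP[t0 t1] q0; pose s := Num.sqrt t.
have s0 : (0 < s)%R by rewrite sqrtr_gt0.
have s1 : (s < 1)%R by rewrite -[ltRHS]sqrtr1 ltr_sqrt.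
have ss : (s * s = t)%R by rewrite -expr2 sqr_sqrtr// ltW.
pose v := (s `^ q)%R; have v0 : (0 < v)%R by rewrite powR_gt0.
have v1 : (v < 1)%R.
  by rewrite /v -[ltRHS](congr1 (@^~ q) (powR1 R)) gt0_ltr_powR// ?nnegrE// ltW.
have sv m : ((s ^+ m) `^ q = v ^+ m)%R.
  by rewrite -[in LHS]powR_mulrn ?(ltW s0)// powRAC powR_mulrn ?powR_ge0//.
have ps m : 0 <= (s ^+ m)%:E by rewrite lee_fin exprn_ge0// ltW.
have pv m : 0 <= (v ^+ m)%:E by rewrite lee_fin exprn_ge0// ltW.
pose A := (2 / (1 - s))%R; pose B := (2 / (1 - v))%R.
have A0 : (0 <= A)%R by rewrite divr_ge0// subr_ge0 ltW.
have B0 : (0 <= B)%R by rewrite divr_ge0// subr_ge0 ltW.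
exists (A `^ q * B)%R; split; first by rewrite mulr_ge0// powR_ge0.
move=> u u0.
(* Because v = s^q, [M k] is the sum of the q-th powers of s^|k-j| u_j, and so dominates the q-th
   power of their supremum; [A] bounds the remaining geometric sum. *)
pose M k := \esum_(j in [set: int]) ((v ^+ `|k - j|%N)%:E * u j `^ q).
have M0 k : 0 <= M k by apply: esum_ge0 => j _; rewrite mule_ge0// poweR_ge0.
have inner k : \esum_(j in [set: int]) ((t ^+ `|k - j|%N)%:E * u j) <=
    A%:E * M k `^ q^-1.
  apply: (@le_trans _ _
    (M k `^ q^-1 * \esum_(j in [set: int]) (s ^+ `|k - j|%N)%:E)).
    apply: le_trans (esum_mull_le _ _); rewrite ?poweR_ge0//.
    apply: le_esum => j _; rewrite -ss exprMn EFinM -muleA muleC lee_wpmul2r//.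
    have -> : (s ^+ `|k - j|)%:E * u j =
        ((v ^+ `|k - j|%N)%:E * u j `^ q) `^ q^-1.
      rewrite poweRM ?poweR_ge0// -poweRrM mulfV ?gt_eqF// poweRe1//.
      rewrite -sv -poweR_EFin -poweRrM mulfV ?gt_eqF// poweRe1//.
    apply: le_poweR; rewrite ?invr_ge0 ?(ltW q0)//.
      by rewrite mule_ge0// poweR_ge0.
    exact: (esum_term_le (fun j => (v ^+ `|k - j|%N)%:E * u j `^ q)).
  rewrite muleC lee_wpmul2r ?poweR_ge0//.
  rewrite (esum_int_shift (fun j => (s ^+ `|j|%N)%:E)).
  by apply: esum_int_geometric; rewrite s0.
apply: (@le_trans _ _ (\esum_(k in [set: int]) ((A `^ q)%:E * M k))).
  apply: le_esum => k _.
  apply: (le_trans (le_poweR (ltW q0) _ (inner k))).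
    by apply: esum_ge0 => j _; rewrite mule_ge0// lee_fin exprn_ge0// ltW.
  by rewrite poweRM ?poweR_ge0// -poweRrM mulVf ?gt_eqF// poweRe1.
apply: (le_trans (esum_mull_le _ _)) => //; first by rewrite lee_fin powR_ge0.
rewrite EFinM -muleA lee_wpmul2l//; first by rewrite lee_fin powR_ge0.
(* Tonelli: for fixed j, the sum over k of v^|k-j| is at most [B]. *)
rewrite /M esum_exchange; last by move=> k j; rewrite mule_ge0// poweR_ge0.
apply: le_trans (esum_mull_le _ _); rewrite ?poweR_ge0//; last first.
  by move=> j _; rewrite poweR_ge0.
apply: le_esum => j _; under eq_esum do rewrite muleC.
apply: (le_trans (esum_mull_le _ _)); rewrite ?poweR_ge0//.
rewrite muleC lee_wpmul2r ?poweR_ge0//.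
under eq_esum do rewrite -abszN opprB.
rewrite (esum_int_shift (fun j => (v ^+ `|j|%N)%:E)).
by apply: esum_int_geometric; rewrite v0.
Qed.

(** Each u_j is at most S^(1/q1), where S is the sum of the q1-th powers. Writing u^q2 = u^(q2-q1)
    u^q1, the first factor is bounded by S^((q2-q1)/q1) and leaves the sum. *)
Lemma esum_poweR_le (T : choiceType) (u : T -> \bar R) (q1 q2 : R) :
  (0 < q1)%R -> (q1 <= q2)%R -> (forall j, 0 <= u j) ->
  (\esum_(j in [set: T]) u j `^ q2) `^ q2^-1 <=
  (\esum_(j in [set: T]) u j `^ q1) `^ q1^-1.
Proof.
move=> q10 q12 u0; set S := \esum_(j in [set: T]) u j `^ q1.
have q20 : (0 < q2)%R := lt_le_trans q10 q12.
have S0 : 0 <= S by apply: esum_ge0 => j _; exact: poweR_ge0.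
suff H : \esum_(j in [set: T]) u j `^ q2 <= S `^ (q2 / q1).
  have -> : S `^ q1^-1 = (S `^ (q2 / q1)) `^ q2^-1.
    by rewrite -poweRrM; congr (_ `^ _); field; rewrite !gt_eqF.
  apply: le_poweR => //; first by rewrite invr_ge0 ltW.
  by apply: esum_ge0 => j _; exact: poweR_ge0.
have -> : (q2 / q1 = (q2 - q1) / q1 + 1)%R by field; rewrite gt_eqF.
rewrite poweRD; last first.
  apply: add_neq0_poweRD_def.
  by rewrite gt_eqF// ltr_wpDl// divr_ge0// ?subr_ge0// ltW.
rewrite poweRe1//; apply: le_trans (esum_mull_le _ _); rewrite ?poweR_ge0//.
  apply: le_esum => j _.
  rewrite -{1}(subrK q1 q2) poweRD; last first.
    by apply: add_neq0_poweRD_def; rewrite subrK gt_eqF.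
  apply: lee_wpmul2r; first exact: poweR_ge0.
  rewrite mulrC poweRrM; apply: le_poweR => //; first by rewrite subr_ge0.
  have -> : u j = (u j `^ q1) `^ q1^-1.
    by rewrite -poweRrM mulfV ?gt_eqF// poweRe1.
  apply: le_poweR; rewrite ?invr_ge0 ?(ltW q10) ?poweR_ge0//.
  exact: (esum_term_le (fun j => u j `^ q1)).
by move=> j _; exact: poweR_ge0.
Qed.

End Discrete.

(** * The geometry of p-adic space *)

Section Residues.
Variables (p : nat) (p_pr : prime p).

Let pgt1 : 1 < (p%:R : rat).
Proof. by rewrite ltr1n prime_gt1. Qed.
Let pgt0 : 0 < (p%:R : rat).
Proof. exact: lt_trans ltr01 pgt1. Qed.

Lemma rat_pnorm_int_le1 (m : int) : rat_pnorm p m%:~R <= 1.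
Proof.
have [->|m0] := eqVneq m 0; first by rewrite rat_pnorm0 ler01.
have := rat_pnorm_div p_pr m0 (isT : (1 : int) != 0); rewrite divr1 => ->.
by rewrite logn1 sub0r -exprnN invf_le1 ?exprn_gt0// exprn_ege1// ltW.
Qed.

Lemma rat_pnorm_dvd (m : int) : (p %| m)%Z -> rat_pnorm p m%:~R <= p%:R^-1.
Proof.
move=> /dvdzP[k ->]; rewrite intrM rat_pnormM// -(rat_pnorm_p p_pr).
rewrite ler_piMl ?rat_pnorm_int_le1// rat_pnorm_ge0//.
Qed.

Lemma rat_pnorm_ndvd (m : int) : ~~ (p %| m)%Z -> rat_pnorm p m%:~R = 1.
Proof.
move=> pm; have m0 : m != 0 by apply: contraNneq pm => ->; rewrite dvdz0.
have := rat_pnorm_div p_pr m0 (isT : (1 : int) != 0); rewrite divr1 => ->.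
rewrite logn1 sub0r (_ : logn p `|m| = 0%N) ?oppr0 ?expr0z//.
by apply/eqP; rewrite -leqn0 leqNgt logn_gt0 mem_primes p_pr absz_gt0 m0.
Qed.

(** In lowest terms q = a/d, the norm bound forces p not to divide d: otherwise |a| = 1 by
    coprimality and |q| >= p. Hence d has an inverse u modulo p, found by Bezout, and the residue is
    a u mod p. *)
Lemma rat_residue (q : rat) : rat_pnorm p q <= 1 ->
  exists c : 'I_p, rat_pnorm p (q - (c : nat)%:R) <= p%:R^-1.
Proof.
move=> q1; set a := numq q; set d := denq q.
have d0 : d%:~R != 0 :> rat by rewrite intr_eq0 denq_neq0.
have qE : q = a%:~R / d%:~R by rewrite divq_num_den.
have cad : coprime `|a| `|d| := coprime_num_den q.
have pd : ~~ (p %| d)%Z.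
  apply/negP => pd; have pa : ~~ (p %| a)%Z.
    apply/negP => pa; have : (p %| gcdn `|a| `|d|)%N.
      by rewrite dvdn_gcd; apply/andP; split.
    move: cad => /eqP; rewrite /a /d => ->; rewrite dvdn1 => /eqP p1.
    by move: p_pr; rewrite p1.
  have := q1; rewrite qE rat_pnormM// rat_pnormV// (rat_pnorm_ndvd pa) mul1r.
  rewrite invf_le1; last by rewrite rat_pnorm_gt0.
  move=> /(le_trans)/(_ (rat_pnorm_dvd pd)).
  by rewrite invf_ge1// leNgt pgt1.
have [u [v uv]] := Bezoutz d p%:Z.
have {}uv : u * d + v * p%:Z = 1.
  rewrite uv /gcdz; congr Posz; apply/eqP; rewrite -/(coprime _ _) coprime_sym.
  by rewrite prime_coprime.
have p0 : p%:Z != 0 by rewrite eqz_nat -lt0n prime_gt0.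
set c := ((a * u) %% p%:Z)%Z.
have cge0 : 0 <= c by apply: modz_ge0.
have cltp : (`|c| < p)%N.
  by have := ltz_mod (a * u) p0; rewrite -/c -{1}(gez0_abs cge0) ltz_nat.
exists (Ordinal cltp) => /=.
have cE : (`|c|%N)%:R = c%:~R :> rat by rewrite -{2}(gez0_abs cge0).
have -> : q - `|c|%N%:R = (a - c * d)%:~R / d%:~R.
  have -> : (a - c * d)%:~R = a%:~R - c%:~R * d%:~R :> rat.
    by rewrite rmorphB rmorphM.
  by rewrite cE {1}qE; field.
rewrite rat_pnormM// rat_pnormV// (rat_pnorm_ndvd pd) invr1 mulr1.
apply: rat_pnorm_dvd.
have -> : a - c * d = (a * v + ((a * u) %/ p%:Z)%Z * d) * p%:Z.
  have := divz_eq (a * u) p%:Z; rewrite -/c; set k := (_ %/ _)%Z => E.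
  have cE' : c = a * u - k * p%:Z by rewrite E; ring.
  have -> : a - c * d = a * (u * d + v * p%:Z) - c * d by rewrite uv mulr1.
  by rewrite cE'; ring.
by rewrite dvdz_mull.
Qed.

(** Two digits differ by an integer of absolute value less than p, which p divides only if it is 0.
    This makes the translates of [pball_digits] disjoint. *)
Lemma rat_residue_inj (c c' : 'I_p) :
  rat_pnorm p ((c : nat)%:R - (c' : nat)%:R) <= p%:R^-1 -> c = c'.
Proof.
move=> cc; apply/val_inj/eqP; apply: contraTT cc => ncc; rewrite -ltNge.
have -> : (c : nat)%:R - (c' : nat)%:R = ((c : nat)%:Z - (c' : nat)%:Z)%:~R :> rat.
  by rewrite rmorphB.
rewrite rat_pnorm_ndvd ?invf_lt1//.
apply/negP => /dvdzP[k kE]; have cp := ltn_ord c; have cp' := ltn_ord c'.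
have : (`|(c : nat)%:Z - (c' : nat)%:Z| < p)%N by lia.
rewrite kE abszM /= -[ltnRHS]mul1n ltn_pmul2r ?prime_gt0// ltnS leqn0 absz_eq0.
move=> /eqP k0; move: kE; rewrite k0 mul0r => /eqP; rewrite subr_eq0.
by rewrite eqz_nat; apply/negP.
Qed.

(** Density reduces this to rationals: by the ultrametric inequality a rational within 1/p of x
    still has norm at most 1, and its residue serves for x. *)
Lemma padic_residue (x : padic p_pr) : padic_norm x <= 1 ->
  exists c : 'I_p, padic_norm (x - padic_of_rat p_pr (c : nat)%:R) <= p%:R^-1.
Proof.
move=> x1; have pV0 : 0 < (p%:R^-1 : rat) by rewrite invr_gt0.
have [q xq] := padic_dense x pV0.
have q1 : rat_pnorm p q <= 1.
  rewrite -(padic_norm_rat p_pr) -(subKr x (padic_of_rat _ q)).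
  rewrite (le_trans (padic_normD _ _))// ge_max x1 padic_normN.
  by rewrite (le_trans (ltW xq))// invf_le1// ltW.
have [c cP] := rat_residue q1; exists c.
rewrite -(subrKA (padic_of_rat p_pr q)) (le_trans (padic_normD _ _))//.
by rewrite ge_max (ltW xq) -rmorphB/= padic_norm_rat.
Qed.

(** The norm of x is attained by the terms of a representing sequence, so completion does not
    enlarge the value group. *)
Lemma padic_norm_exp (x : padic p_pr) : x != 0 ->
  exists k : int, padic_norm x = p%:R ^ k.
Proof.
move=> x0; have [N /(_ N (leqnn N)) xN] := padic_norm_repr x0.
have := padic_norm_gt0 x0; rewrite -xN.
have [->|q0 _] := eqVneq ((repr x : cauchy_seq_of p_pr) N) 0.
  by rewrite rat_pnorm0 ltxx.
by rewrite /rat_pnorm (negPf q0); eexists.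
Qed.

End Residues.

(** * Balls, spheres and coset decompositions *)

Section Space.
Variables (p : nat) (p_pr : prime p) (n : nat).
Local Notation T := (padic_space p_pr n).
Local Notation vec := 'rV[padic p_pr]_n.
Implicit Types (x y : vec) (k l : int).

Let pgt1 : 1 < (p%:R : rat).
Proof. by rewrite ltr1n prime_gt1. Qed.
Let pgt0 : 0 < (p%:R : rat).
Proof. exact: lt_trans ltr01 pgt1. Qed.
Let pexp_gt0 k : 0 < (p%:R : rat) ^ k.
Proof. by rewrite exprz_gt0. Qed.

Lemma pnorm_ge0 x : 0 <= pnorm x.
Proof.
rewrite /pnorm; elim/big_ind: _ => // [a b a0 _|j _]; first by rewrite le_max a0.
exact: padic_norm_ge0.
Qed.

Lemma pnorm_leP x c : 0 <= c ->
  (pnorm x <= c <-> forall j, padic_norm (x ord0 j) <= c).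
Proof.
move=> c0; split; last by move=> H; rewrite /pnorm; apply: bigmax_le.
move=> xc j; apply: le_trans xc; rewrite /pnorm.
exact: (le_bigmax _ (fun j => padic_norm (x ord0 j))).
Qed.

Lemma pnormD x y c : 0 <= c -> pnorm x <= c -> pnorm y <= c -> pnorm (x + y) <= c.
Proof.
move=> c0 /(pnorm_leP _ c0) xc /(pnorm_leP _ c0) yc; apply/pnorm_leP => // j.
by rewrite mxE (le_trans (padic_normD _ _))// ge_max xc yc.
Qed.

Lemma pnormN x : pnorm (- x) = pnorm x.
Proof. by rewrite /pnorm; apply: eq_bigr => j _; rewrite mxE padic_normN. Qed.

Lemma pnorm0 : pnorm (0 : vec) = 0.
Proof.
apply/eqP; rewrite eq_le pnorm_ge0 andbT; apply/pnorm_leP => // j.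
by rewrite mxE padic_norm0.
Qed.

Lemma pnorm_eq0 x : pnorm x = 0 -> x = 0.
Proof.
move=> x0; apply/rowP => j; rewrite mxE; apply/eqP.
rewrite -padic_norm_eq0 eq_le padic_norm_ge0 andbT.
by move: j; apply/pnorm_leP => //; rewrite x0.
Qed.

Lemma pnorm_exp x : x != 0 -> exists k : int, pnorm x = p%:R ^ k.
Proof.
move=> x0; have : pnorm x = 0 \/ exists k : int, pnorm x = p%:R ^ k.
  rewrite /pnorm; elim/big_ind: _ => [|a b Ha Hb|j _]; first by left.
    by case: (leP a b).
  have [->|/padic_norm_exp[k ->]] := eqVneq (x ord0 j) 0.
    by left; rewrite padic_norm0.
  by right; exists k.
by case=> // /pnorm_eq0 /eqP; rewrite (negPf x0).
Qed.

(* The exponent of [pnorm x]; the value at the origin is junk. *)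
Definition level x : int := xget 0 [set k | pnorm x = p%:R ^ k].

Lemma pnorm_level x : x != 0 -> pnorm x = p%:R ^ level x.
Proof. by move=> /pnorm_exp[k kP]; rewrite /level; case: xgetP => // /(_ k). Qed.

Lemma pballE k x : pball p_pr n k x <-> x = 0 \/ (x != 0) && (level x <= k).
Proof.
rewrite /pball /=; have [->|x0] := eqVneq x 0.
  by rewrite pnorm0; split=> _; [left|exact: ltW].
rewrite pnorm_level// ler_eXz2l//; split; first by right.
by case=> // x0'; move: x0; rewrite x0' eqxx.
Qed.

Lemma psphereE k x : psphere p_pr n k x <-> x != 0 /\ level x = k.
Proof.
rewrite /psphere /setD /= !pballE; split.
  move=> [[->|/andP[x0 xk]] H]; first by exfalso; apply: H; left.
  split => //; apply/eqP; rewrite eq_le xk /= leNgt; apply/negP => kx; apply: H.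
  by right; rewrite x0 /=; lia.
move=> [x0 <-]; split; first by right; rewrite x0 lexx.
by case=> [/eqP|/andP[_]]; [rewrite (negPf x0)|lia].
Qed.

Lemma pball_ofE x : x != 0 -> pball_of (x : T) = pball p_pr n (level x).
Proof.
by move=> x0; apply/seteqP; split => t; rewrite /pball_of /pball /= (pnorm_level x0).
Qed.

Lemma psphere_sub_pball k l : k <= l -> psphere p_pr n k `<=` pball p_pr n l.
Proof. by move=> kl x /psphereE[x0 xk]; apply/pballE; right; rewrite x0 xk. Qed.

Lemma sub_pball k l : k <= l -> pball p_pr n k `<=` pball p_pr n l.
Proof.
move=> kl x /pballE H; apply/pballE; case: H => [->|/andP[x0 xk]]; first by left.
by right; rewrite x0 (le_trans xk).
Qed.

Lemma measurable_pball k : measurable (pball p_pr n k).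
Proof.
apply: sub_sigma_algebra => a ak; exists k => x xk.
by rewrite /pball /= -(subrK a x) pnormD// ltW.
Qed.

Lemma measurable_psphere k : measurable (psphere p_pr n k).
Proof. by apply: measurableD; exact: measurable_pball. Qed.

Lemma bigcap_pball : \bigcap_m pball p_pr n (- (m%:Z)) = [set 0].
Proof.
apply/seteqP; split => [x xm|_ -> m _]; last by apply/pballE; left.
apply: contrapT => /eqP x0.
have /pballE[/eqP|] := xm `|level x|.+1 I; first by rewrite (negPf x0).
by rewrite x0 /=; lia.
Qed.

Lemma measurable_origin : measurable ([set 0] : set T).
Proof.
rewrite -bigcap_pball; apply: bigcapT_measurable => m; exact: measurable_pball.
Qed.

Lemma setT_spheres : [set: T] = [set 0] `|` \bigcup_k psphere p_pr n k.
Proof.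
apply/seteqP; split => // x _; have [->|x0] := eqVneq x 0; first by left.
by right; exists (level x) => //; apply/psphereE.
Qed.

Lemma trivIset_psphere : trivIset setT (psphere p_pr n).
Proof. by move=> k l _ _ [x [/psphereE[_ <-] /psphereE[_ <-]]]. Qed.

Lemma countable_int : countable [set: int].
Proof. exact: countableP. Qed.

(** The preimage is a countable union of whole spheres together with at most the origin, all of them
    Borel, whatever the value of g at the origin. The Hardy transforms are thus measurable without a
    Fubini argument. *)
Lemma measurable_radial d (Y : measurableType d) (g : T -> Y) :
  (forall x y, x != 0 -> y != 0 -> level x = level y -> g x = g y) ->
  measurable_fun [set: T] g.
Proof.
move=> gE _ A mA; rewrite setTI.
have -> : g @^-1` A = (([set 0] `&` g @^-1` A) `|`
    \bigcup_k (psphere p_pr n k `&` g @^-1` A)).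
  by rewrite -setI_bigcupl -setIUl -setT_spheres setTI.
apply: measurableU; last apply: countable_bigcupT_measurable.
- case: (pselect (A (g 0))) => A0.
    rewrite (_ : _ `&` _ = [set 0]); first exact: measurable_origin.
    by apply/seteqP; split => x [] // ->.
  by rewrite (_ : _ `&` _ = set0)//; apply/seteqP; split => x // [/= ->].
- exact: countable_int.
- move=> k.
  case: (pselect (exists2 x, psphere p_pr n k x & A (g x))) => [[x xk Agx]|H].
    rewrite (_ : _ `&` _ = psphere p_pr n k); first exact: measurable_psphere.
    apply/seteqP; split => y; first by case.
    move=> yk; split => //=; suff -> : g y = g x by [].
    by move: xk yk => /psphereE[x0 <-] /psphereE[y0 yx]; exact: gE.
  rewrite (_ : _ `&` _ = set0)//; apply/seteqP; split => x // [xk Agx].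
  by apply: H; exists x.
Qed.

(** Representatives of the cosets of B_(k-1) in B_k: vectors p^(-k) c whose digits c_j run over the
    residues modulo p. *)
Definition digits (k : int) (c : {ffun 'I_n -> 'I_p}) : vec :=
  \row_j (padic_of_rat p_pr (p%:R ^ (- k)) * padic_of_rat p_pr (c j : nat)%:R).

Lemma padic_norm_exprz k : padic_norm (padic_of_rat p_pr (p%:R ^ k)) = p%:R ^ (- k).
Proof.
have p0 : (p%:R : rat) != 0 by rewrite gt_eqF.
rewrite padic_norm_rat; case: k => m.
  elim: m => [|m IH]; first by rewrite !expr0z rat_pnorm1.
  rewrite intS exprzDr ?unitfE// rat_pnormM// IH expr1z rat_pnorm_p//.
  by rewrite opprD exprzDr ?unitfE// exprN1.
rewrite NegzE -exprnN rat_pnormV// opprK.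
elim: m => [|m IH]; first by rewrite expr1 rat_pnorm_p// invrK expr1z.
by rewrite exprS rat_pnormM// invfM IH rat_pnorm_p// invrK -exprS.
Qed.

(** Multiplication by p^k carries B_k into the unit ball, where [padic_residue] gives a digit in
    each coordinate; scaling back leaves a remainder in B_(k-1). *)
Lemma pball_digits k : pball p_pr n k =
  \bigcup_(c in [set: {ffun 'I_n -> 'I_p}])
    [set digits k c + x | x in pball p_pr n (k - 1)].
Proof.
have p0 : (p%:R : rat) != 0 by rewrite gt_eqF.
have ck c : pnorm (digits k c) <= p%:R ^ k.
  apply/pnorm_leP; first exact: ltW.
  move=> j; rewrite mxE padic_normM padic_norm_exprz opprK ler_piMr ?(ltW (pexp_gt0 k))//.
  by rewrite padic_norm_rat (rat_pnorm_int_le1 p_pr (c j)%:Z).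
apply/seteqP; split=> [x xk|_ [c _ [x xk <-]]]; last first.
  rewrite /pball /=; apply: pnormD => //; first exact: ltW.
  by apply: (le_trans xk); rewrite ler_eXz2l// gerBl.
have : forall j, exists c : 'I_p,
    padic_norm (padic_of_rat p_pr (p%:R ^ k) * x ord0 j
      - padic_of_rat p_pr (c : nat)%:R) <= p%:R^-1.
  move=> j; apply: padic_residue; rewrite padic_normM padic_norm_exprz.
  have xj : padic_norm (x ord0 j) <= p%:R ^ k.
    by apply: (pnorm_leP _ _).1 => //; exact: ltW.
  apply: (le_trans (ler_wpM2l _ xj)); first exact: ltW.
  by rewrite -expfzDr// addNr.
move=> /choice[c cP]; exists (finfun c) => //.
exists (x - digits k (finfun c)); last by rewrite addrC subrK.
apply/pnorm_leP; first exact: ltW.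
move=> j; rewrite !mxE ffunE.
have -> : x ord0 j - padic_of_rat p_pr (p%:R ^ (- k)) * padic_of_rat p_pr (c j : nat)%:R
   = padic_of_rat p_pr (p%:R ^ (- k)) *
   (padic_of_rat p_pr (p%:R ^ k) * x ord0 j - padic_of_rat p_pr (c j : nat)%:R).
  have E : padic_of_rat p_pr (p%:R ^ (- k)) * padic_of_rat p_pr (p%:R ^ k) = 1.
    by rewrite -rmorphM/= -expfzDr// addNr expr0z rmorph1.
  by rewrite mulrBr mulrA E mul1r.
rewrite padic_normM padic_norm_exprz opprK expfzDr// exprN1.
by rewrite ler_wpM2l// ltW.
Qed.

Lemma trivIset_digits k : trivIset [set: {ffun 'I_n -> 'I_p}]
  (fun c => [set digits k c + x | x in pball p_pr n (k - 1)]).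
Proof.
have p0 : (p%:R : rat) != 0 by rewrite gt_eqF.
move=> c c' _ _ [_ [[x xk <-] [y yk xy]]]; apply/ffunP => j.
apply: (rat_residue_inj p_pr).
have : padic_norm ((y - x) ord0 j) <= p%:R ^ (k - 1).
  apply: (pnorm_leP _ _).1; first exact: ltW.
  by apply: pnormD; rewrite ?pnormN//; exact: ltW.
have -> : y - x = digits k c - digits k c'.
  have -> : y = digits k c + x - digits k c' by rewrite -xy addrC addKr.
  by rewrite addrAC addrK.
rewrite !mxE -mulrBr -rmorphB/= padic_normM padic_norm_exprz opprK expfzDr// exprN1.
by rewrite ler_pM2l// padic_norm_rat.
Qed.

(** * Haar measure of balls and integration over spheres *)

Section Haar.
Variables (R : realType) (mu : {measure set T -> \bar R}).
Hypothesis mu_haar : haar_measure mu.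

Let pR0 : (p%:R : R) != 0.
Proof. by rewrite pnatr_eq0 -lt0n prime_gt0. Qed.

(** B_k is the disjoint union of p^n translates of B_(k-1), which are open and have equal measure by
    invariance. *)
Lemma haar_pballS k :
  mu (pball p_pr n k) = ((p%:R ^+ n)%:E * mu (pball p_pr n (k - 1)))%E.
Proof.
have [_ inv] := mu_haar.
have mB := measurable_pball (k - 1).
have mt c : measurable ([set digits k c + x | x in pball p_pr n (k - 1)] : set T).
  rewrite (_ : [set _ | _ in _] = [set x : T | pball_at (digits k c) (k - 1) x]).
    apply: sub_sigma_algebra => a ak; exists (k - 1) => x xk.
    have E : pnorm ((x - a) + (a - digits k c)) <= p%:R ^ (k - 1).
      by apply: pnormD; [exact: ltW|exact: xk|exact: ak].
    by rewrite subrKA in E.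
  apply/seteqP; split => [_ [x xk <-]|x xk] /=.
    by rewrite /pball_at /= addrC addKr.
  by exists (x - digits k c) => //; rewrite addrC subrK.
have fT : finite_set [set: {ffun 'I_n -> 'I_p}] by exact: finite_finset.
rewrite pball_digits measure_fin_bigcup//; last exact: trivIset_digits.
rewrite fsbig_finite//= (eq_bigr (fun=> mu (pball p_pr n (k - 1)))); last first.
  by move=> c _; exact: inv.
have E : perm_eq (fset_set [set: {ffun 'I_n -> 'I_p}])
    (index_enum {ffun 'I_n -> 'I_p}).
  apply: uniq_perm; [exact: fset_uniq|exact: index_enum_uniq|].
  by move=> c; rewrite mem_index_enum in_fset_set ?in_setT.
rewrite (perm_big _ E)/= sumr_const card_ffun !card_ord.
by have := mule_natl (mu (pball p_pr n (k - 1))) (p ^ n); rewrite natrX => ->.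
Qed.

Lemma haar_pball k : mu (pball p_pr n k) = ((p%:R ^+ n) ^ k)%:E.
Proof.
have Q0 : (p%:R ^+ n : R) != 0 by rewrite expf_neq0.
have [mu0 _] := mu_haar.
case: k => m; [elim: m => [|m IH]|elim: m => [|m IH]].
- by rewrite expr0z.
- by rewrite haar_pballS intS addrAC subrr add0r IH exprzDr ?unitfE// expr1z.
- have := haar_pballS 0; rewrite mu0 sub0r NegzE => E.
  (* Going down, finiteness of the smaller ball comes first: an infinite measure would stay infinite
     after multiplication by p^n. Only then can p^n be cancelled. *)
  have fB : mu (pball p_pr n (-1)) \is a fin_num.
    rewrite ge0_fin_numE// ltey; apply/eqP => Ey; move: E; rewrite Ey.
    by rewrite gt0_muley ?lte_fin ?exprn_gt0 ?ltr0n ?prime_gt0.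
  move: E; rewrite -(fineK fB) -EFinM => -[E]; congr (_%:E).
  by apply: (mulfI Q0); rewrite -E exprN1 mulfV.
- have := haar_pballS (Negz m); rewrite IH !NegzE.
  have -> : - (m.+1%:Z) - 1 = - (m.+2%:Z) by lia.
  move=> E; have fB : mu (pball p_pr n (- (m.+2%:Z))) \is a fin_num.
    rewrite ge0_fin_numE// ltey; apply/eqP => Ey; move: E; rewrite Ey.
    by rewrite gt0_muley ?lte_fin ?exprn_gt0 ?ltr0n ?prime_gt0.
  move: E; rewrite -(fineK fB) -EFinM => -[E]; congr (_%:E).
  apply: (mulfI Q0); rewrite -E -{2}(expr1z (p%:R ^+ n)) -expfzDr//.
  by congr (_ ^ _); lia.
Qed.

(** The origin lies in balls of volume p^(-nm) for all m. For n = 0 the space is a single point of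
    measure 1, hence the hypothesis. *)
Lemma haar_origin : (0 < n)%N -> mu ([set 0] : set T) = 0%E.
Proof.
move=> n0; apply/eqP; rewrite eq_le measure_ge0 andbT.
have Q1 : 1 < (p%:R ^+ n : R) by rewrite exprn_egt1 -?lt0n// ltr1n prime_gt1.
apply/lee_addgt0Pr => e e0; rewrite add0e.
have [m me] : exists m : nat, (p%:R ^+ n : R) ^- m < e.
  have Qn : `|(p%:R ^+ n : R)^-1| < 1.
    by rewrite ger0_norm ?invr_ge0 ?exprn_ge0// invf_lt1 ?exprn_gt0 ?ltr0n ?prime_gt0.
  have /cvgrPdist_lt/(_ _ e0) := cvg_expr Qn.
  move=> [m _ /(_ m (leqnn m))]; rewrite sub0r normrN exprVn => H.
  by exists m; apply: le_lt_trans H; exact: ler_norm.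
apply: (@le_trans _ _ (mu (pball p_pr n (- m%:Z)))); last first.
  by rewrite haar_pball -exprnN lee_fin ltW.
apply: le_measure; rewrite ?inE.
- exact: measurable_origin.
- exact: measurable_pball.
- by move=> _ ->; apply/pballE; left.
Qed.

Lemma integral_spheres (D : set T) (g : T -> \bar R) : (0 < n)%N ->
  measurable D -> measurable_fun D g -> (forall x, D x -> (0 <= g x)%E) ->
  (\int[mu]_(x in D) g x =
   \esum_(k in [set: int]) \int[mu]_(x in D `&` psphere p_pr n k) g x)%E.
Proof.
move=> n0 mD mg g0.
have m0 := measurable_origin; have mS := measurable_psphere.
(* Countable additivity is indexed by [nat], so the spheres are renumbered through the pickling of
   [int]; codes that are not attained receive the empty set and contribute 0. *)
pose F (i : nat) : set T :=
  if pickle_inv i is Some k then D `&` psphere p_pr n k else set0.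
have mF i : measurable (F i).
  by rewrite /F; case: pickle_inv => // k; apply: measurableI.
have FD i : F i `<=` D by rewrite /F; case: pickle_inv => // k x [].
have DE : D = (D `&` [set 0]) `|` \bigcup_i F i.
  apply/seteqP; split=> [x Dx|x [[]//|[i _ /FD//]]].
  have [x0|x0] := eqVneq x 0; first by left.
  right; exists (choice.pickle (level x)); first exact: I.
  by rewrite /F pickleK_inv; split => //; apply/psphereE.
have tF : trivIset setT F.
  move=> i j _ _ [x []]; rewrite /F.
  have := @pickle_invK int i; have := @pickle_invK int j.
  case: (pickle_inv i) => [k|]//; case: (pickle_inv j) => [l|]//= <- <-.
  move=> [_ xk] [_ xl]; congr choice.pickle.
  by apply: (trivIset_psphere (i := k) (j := l)) => //; exists x.
have mbF : measurable (\bigcup_i F i) by apply: bigcupT_measurable.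
have bFD : \bigcup_i F i `<=` D by move=> x [i _ /FD].
rewrite {1}DE ge0_integral_setU//; first last.
- apply/disj_setPS => x [[_ /= ->] [i _]].
  by rewrite /F; case: pickle_inv => // k [_ /psphereE[]]; rewrite eqxx.
- by rewrite -DE.
- by rewrite -DE.
- exact: measurableI.
rewrite null_set_integral ?add0e; first last.
- apply/eqP; rewrite eq_le measure_ge0 andbT -(haar_origin n0).
  by apply: le_measure; rewrite ?inE//; exact: measurableI.
- by apply: measurable_funS mg => // x [].
- exact: measurableI.
rewrite ge0_integral_bigcup//; first last.
- by move=> x /bFD /g0.
- exact: measurable_funS mg.
rewrite nneseries_esumT; last first.
  by move=> i; apply: integral_ge0 => x /FD /g0.
rewrite [LHS](_ : _ =
  \esum_(i in range (@choice.pickle int)) \int[mu]_(x in F i) g x)%E; last first.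
  rewrite [RHS]esum_mkcond.
apply: eq_esum => i _; case: ifPn => //.
  rewrite notin_setE /F; have := @pickle_invK int i.
  by case: pickle_inv => [k /= <- []|_ _]; [exists k|rewrite integral_set0].
rewrite esum_image; last by move=> k l _ _; exact: (pcan_inj choice.pickleK).
by apply: eq_esum => k _; rewrite /F pickleK_inv.
Qed.

End Haar.
End Space.

(** * Complex-valued functions *)

Section ComplexFunctions.
Variables (R : realType) (p : nat) (p_pr : prime p) (n : nat).
Local Notation T := (padic_space p_pr n).
Implicit Types (z : R[i]) (f g : T -> R[i]).

Lemma cmod_ge0 z : 0 <= cmod z.
Proof. by case: z => a b; rewrite /cmod /= sqrtr_ge0. Qed.

Lemma cmodM z1 z2 : cmod (z1 * z2) = cmod z1 * cmod z2.
Proof. exact: Normc.normcM. Qed.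

Lemma cmodD z1 z2 : cmod (z1 + z2) <= cmod z1 + cmod z2.
Proof. exact: le_normcD. Qed.

Lemma cmodN z : cmod (- z) = cmod z.
Proof. exact: normcN. Qed.

Lemma cmodB z1 z2 : cmod (z1 - z2) <= cmod z1 + cmod z2.
Proof. by rewrite -(cmodN z2); exact: cmodD. Qed.

Lemma cmod_real (a : R) : cmod a%:C%C = `|a|.
Proof. by rewrite /cmod /= expr0n /= addr0 sqrtr_sqr. Qed.

Lemma cmod_Re z : `|complex.Re z| <= cmod z.
Proof.
by case: z => a b; rewrite /cmod /= -sqrtr_sqr ler_wsqrtr// lerDl sqr_ge0.
Qed.

Lemma cmod_Im z : `|complex.Im z| <= cmod z.
Proof.
by case: z => a b; rewrite /cmod /= -sqrtr_sqr ler_wsqrtr// lerDr sqr_ge0.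
Qed.

Lemma cmod_le z : cmod z <= `|complex.Re z| + `|complex.Im z|.
Proof.
case: z => a b; rewrite /cmod /= -[leRHS]ger0_norm ?addr_ge0// -sqrtr_sqr.
apply: ler_wsqrtr; rewrite -(real_normK (num_real a)) -(real_normK (num_real b)).
by have := normr_ge0 a; have := normr_ge0 b; nra.
Qed.

Lemma cmeasurable_cmod f : cmeasurable f -> measurable_fun [set: T] (fun x => cmod (f x)).
Proof.
move=> [mRe mIm].
rewrite (_ : (fun x => _) =
  (fun x => (complex.Re (f x) ^+ 2 + complex.Im (f x) ^+ 2) `^ 2^-1)).
  apply: (measurableT_comp (measurable_powR _)).
  by apply: measurable_funD; apply: measurable_funX.
apply/funext => x /=; rewrite powR12_sqrt ?addr_ge0 ?sqr_ge0//.
by rewrite /cmod; case: (f x).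
Qed.

Lemma cmeasurable_cst z : cmeasurable (fun _ : T => z).
Proof. by split; exact: measurable_cst. Qed.

Lemma cmeasurable_real (h : T -> R) :
  measurable_fun [set: T] h -> cmeasurable (fun x => (h x)%:C%C).
Proof. by split => //=; exact: measurable_cst. Qed.

Lemma cmeasurableB f g :
  cmeasurable f -> cmeasurable g -> cmeasurable (fun x => f x - g x).
Proof.
move=> [fR fI] [gR gI]; split.
- rewrite (_ : (fun _ => _) = (fun x => complex.Re (f x) - complex.Re (g x))).
    exact: measurable_funB.
  by apply/funext => x; rewrite raddfB.
- rewrite (_ : (fun _ => _) = (fun x => complex.Im (f x) - complex.Im (g x))).
    exact: measurable_funB.
  by apply/funext => x; rewrite raddfB.
Qed.

Lemma cmeasurableM f g :
  cmeasurable f -> cmeasurable g -> cmeasurable (fun x => f x * g x).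
Proof.
move=> [fR fI] [gR gI]; split.
- rewrite (_ : (fun _ => _) = (fun x => complex.Re (f x) * complex.Re (g x) -
    complex.Im (f x) * complex.Im (g x))).
    by apply: measurable_funB; apply: measurable_funM.
  by apply/funext => x; case: (f x) (g x) => a b [].
- rewrite (_ : (fun _ => _) = (fun x => complex.Re (f x) * complex.Im (g x) +
    complex.Im (f x) * complex.Re (g x))).
    by apply: measurable_funD; apply: measurable_funM.
  by apply/funext => x; case: (f x) (g x) => a b [].
Qed.

Lemma cmeasurable_radial f :
  (forall x y, x != 0 -> y != 0 -> level x = level y -> f x = f y) ->
  cmeasurable f.
Proof.
by move=> fE; split; apply: measurable_radial => x y x0 y0 xy; rewrite (fE x y).
Qed.

Variable mu : {measure set T -> \bar R}.
Implicit Type D : set T.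

Lemma cmod_integrable D f : measurable D -> cmeasurable f ->
  (\int[mu]_(x in D) (cmod (f x))%:E < +oo)%E -> cintegrable mu D f.
Proof.
move=> mD mf foo; have [fR fI] := mf.
have iD : mu.-integrable D (fun x => (cmod (f x))%:E).
  apply/integrableP; split.
    apply/measurable_EFinP; apply: measurable_funS (cmeasurable_cmod mf) => //.
  apply: le_lt_trans foo; apply: ge0_le_integral => //.
  - apply/measurable_EFinP; apply: measurableT_comp => //.
    by apply: measurable_funS (cmeasurable_cmod mf).
  - by apply/measurable_EFinP; apply: measurable_funS (cmeasurable_cmod mf).
  by move=> x _; rewrite lee_fin ger0_norm ?cmod_ge0.
split; apply: le_integrable iD => //.
- by apply/measurable_EFinP; apply: measurable_funS fR.
- by move=> x _ /=; rewrite lee_fin (ger0_norm (cmod_ge0 _)) cmod_Re.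
- by apply/measurable_EFinP; apply: measurable_funS fI.
- by move=> x _ /=; rewrite lee_fin (ger0_norm (cmod_ge0 _)) cmod_Im.
Qed.

(** The real and imaginary parts are bounded separately, which costs the factor 2. Since [fine]
    sends an infinite value to 0, the bound also covers divergent integrals. *)
Lemma cmod_cintegral_le D f : measurable D -> cmeasurable f ->
  ((cmod (cintegral mu D f))%:E <= 2%:E * \int[mu]_(x in D) (cmod (f x))%:E)%E.
Proof.
move=> mD mf; have [fR fI] := mf.
have mcf : measurable_fun D (fun x => (cmod (f x))%:E).
  by apply/measurable_EFinP; apply: measurable_funS (cmeasurable_cmod mf).
have fine_le (x : \bar R) : (`|fine x|%:E <= `|x|)%E.
  by case: x => //=; rewrite normr0 leey.
have H (h : T -> R) : measurable_fun [set: T] h ->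
    (forall x, `|h x| <= cmod (f x)) ->
    (`|\int[mu]_(x in D) h x|%:E <= \int[mu]_(x in D) (cmod (f x))%:E)%E.
  move=> mh hf; apply: (le_trans (fine_le _)).
  have mhD : measurable_fun D (fun x => (h x)%:E).
    by apply/measurable_EFinP; apply: measurable_funS mh.
  apply: (le_trans (le_abse_integral _ _ _)) => //.
  apply: ge0_le_integral => //.
  + exact: measurableT_comp.
  + by move=> x _; rewrite lee_fin.
apply: (@le_trans _ _ (`|complex.Re (cintegral mu D f)| +
    `|complex.Im (cintegral mu D f)|)%:E); first by rewrite lee_fin cmod_le.
rewrite EFinD (_ : 2%:E = (1 + 1)%:E)// EFinD ge0_muleDl// ?mul1e.
by apply: leeD; apply: H => // x; [exact: cmod_Re|exact: cmod_Im].
Qed.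

Lemma cintegralD D f g : measurable D -> cintegrable mu D f -> cintegrable mu D g ->
  cintegral mu D (fun x => f x + g x) = cintegral mu D f + cintegral mu D g.
Proof.
move=> mD [fR fI] [gR gI]; rewrite /cintegral.
have -> : (fun x => complex.Re (f x + g x)) =
    (fun x => complex.Re (f x) + complex.Re (g x)).
  by apply/funext => x; rewrite raddfD.
have -> : (fun x => complex.Im (f x + g x)) =
    (fun x => complex.Im (f x) + complex.Im (g x)).
  by apply/funext => x; rewrite raddfD.
by rewrite !RintegralD.
Qed.

Lemma cintegrableZl D f z : measurable D -> cintegrable mu D f ->
  cintegrable mu D (fun x => z * f x).
Proof.
move=> mD [fR fI]; case: z => a b; split.
- rewrite (_ : (fun _ => _) =
    (fun x => a%:E * (complex.Re (f x))%:E - b%:E * (complex.Im (f x))%:E)%E).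
    by apply: integrableB => //; exact: integrableZl.
  by apply/funext => x; case: (f x).
- rewrite (_ : (fun _ => _) =
    (fun x => a%:E * (complex.Im (f x))%:E + b%:E * (complex.Re (f x))%:E)%E).
    by apply: integrableD => //; exact: integrableZl.
  by apply/funext => x; case: (f x).
Qed.

Lemma cintegralZl D f z : measurable D -> cintegrable mu D f ->
  cintegral mu D (fun x => z * f x) = z * cintegral mu D f.
Proof.
move=> mD [fR fI]; rewrite /cintegral.
case: z => a b.
have iZ h c : mu.-integrable D (fun x : T => (h x)%:E) ->
    mu.-integrable D (EFin \o (fun x : T => c * h x)).
  by move=> ih; exact: (integrableZl mD c ih).
have -> : (fun x => complex.Re (Complex a b * f x)) =
    (fun x => a * complex.Re (f x) - b * complex.Im (f x)).
  by apply/funext => x; case: (f x).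
have -> : (fun x => complex.Im (Complex a b * f x)) =
    (fun x => a * complex.Im (f x) + b * complex.Re (f x)).
  by apply/funext => x; case: (f x).
rewrite RintegralB ?RintegralD ?RintegralZl//; do ?exact: iZ.
Qed.

End ComplexFunctions.

(** * Power integrals *)

Section PowerIntegrals.
Context d (T : measurableType d) (R : realType).
Variable mu : {measure set T -> \bar R}.
Implicit Types (D : set T) (f g h : T -> R).

Lemma measurable_EFin_powR D g (u : R) : measurable D ->
  measurable_fun [set: T] g -> measurable_fun D (fun x => (g x `^ u)%:E).
Proof.
move=> mD mg; apply/measurable_EFinP.
apply: (measurable_funS measurableT) => //.
exact: (measurableT_comp (measurable_powR _)).
Qed.

(* Comparing [L^u] and [L^s] averages by [y ^ u <= 1 + y ^ s] instead of
   Jensen's inequality costs only the factor 2. *)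
Lemma powR_integral_le D g h (a N V s u : R) :
  measurable D -> measurable_fun [set: T] g -> measurable_fun [set: T] h ->
  0 <= a -> 0 < N -> 1 <= u -> u <= s -> (mu D <= V%:E)%E ->
  (forall x, D x -> 0 <= g x) -> (forall x, 0 <= h x) ->
  (forall x, D x -> g x <= a * Num.max 1 (h x / N)) ->
  (\int[mu]_(x in D) (h x `^ s)%:E <= (V * N `^ s)%:E)%E ->
  (\int[mu]_(x in D) (g x `^ u)%:E <= (V * (2 * a) `^ u)%:E)%E.
Proof.
move=> mD mg mh a0 N0 u1 us DV g0 h0 gle hle.
have u0 : 0 <= u by rewrite (le_trans _ u1).
have mhs : measurable_fun D (fun x => (N^-1 `^ s * h x `^ s)%:E).
  under eq_fun do rewrite EFinM.
  by apply: emeasurable_funM; [exact: measurable_cst|exact: measurable_EFin_powR].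
apply: (@le_trans _ _ (\int[mu]_(x in D) ((a `^ u)%:E *
    (1%:E + (N^-1 `^ s * h x `^ s)%:E)))%E).
  apply: ge0_le_integral => //.
  - by move=> x _; rewrite lee_fin powR_ge0.
  - exact: measurable_EFin_powR.
  - apply: emeasurable_funM => //; apply: emeasurable_funD => //.
  - move=> x Dx; rewrite -EFinD -EFinM lee_fin.
    apply: (@le_trans _ _ ((a * Num.max 1 (h x / N)) `^ u)).
      by apply: ge0_ler_powR; rewrite ?nnegrE ?g0 ?(le_trans _ (gle x Dx)) ?g0 ?gle.
    have m0 : 0 <= Num.max 1 (h x / N) by rewrite le_max ler01.
    rewrite powRM// ler_wpM2l ?powR_ge0//.
    case: (leP (h x / N) 1) => hN.
      by rewrite powR1 lerDl mulr_ge0 ?powR_ge0.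
    apply: (@le_trans _ _ ((h x / N) `^ s)); first by rewrite ler_powR// ltW.
    by rewrite mulrC powRM ?invr_ge0 ?(ltW N0)// lerDr.
rewrite ge0_integralZl//; last 3 first.
- by apply: emeasurable_funD => //; exact: measurable_cst.
- by move=> x _; rewrite -EFinD lee_fin addr_ge0// mulr_ge0 ?powR_ge0.
- by rewrite lee_fin powR_ge0.
rewrite ge0_integralD//; last first.
  by move=> x _; rewrite lee_fin mulr_ge0 ?powR_ge0.
rewrite integral_cst// mul1e.
under eq_integral do rewrite EFinM.
rewrite ge0_integralZl//; last 3 first.
- exact: measurable_EFin_powR.
- by move=> x _; rewrite lee_fin powR_ge0.
- by rewrite lee_fin powR_ge0.
have NN : N^-1 `^ s * N `^ s = 1.
  by rewrite -powRM ?invr_ge0 ?(ltW N0)// mulVf ?gt_eqF// powR1.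
have V0 : 0 <= V by rewrite -lee_fin (le_trans _ DV).
apply: (@le_trans _ _ ((a `^ u)%:E * (V%:E + (N^-1 `^ s)%:E * (V * N `^ s)%:E))%E).
  apply: lee_wpmul2l; first by rewrite lee_fin powR_ge0.
  by apply: leeD => //; apply: lee_wpmul2l => //; rewrite lee_fin powR_ge0.
rewrite -EFinM lee_fin (mulrCA _ V) NN mulr1 powRM//.
(* As 1 <= u, the factor 2 is absorbed into the power: 2 <= 2^u. *)
have -> : a `^ u * (V + V) = V * (2 * a `^ u) by ring.
rewrite ler_wpM2l// ler_wpM2r ?powR_ge0// -{1}(powRr1 (ler0n R 2)).
by rewrite ler_powR// ler1n.
Qed.

Lemma integral_le_powR D g h (a N V s : R) :
  measurable D -> measurable_fun [set: T] g -> measurable_fun [set: T] h ->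
  0 <= a -> 0 < N -> 1 <= s -> (mu D <= V%:E)%E ->
  (forall x, D x -> 0 <= g x) -> (forall x, 0 <= h x) ->
  (forall x, D x -> g x <= a * Num.max 1 (h x / N)) ->
  (\int[mu]_(x in D) (h x `^ s)%:E <= (V * N `^ s)%:E)%E ->
  (\int[mu]_(x in D) (g x)%:E <= (V * (2 * a))%:E)%E.
Proof.
move=> mD mg mh a0 N0 s1 DV g0 h0 gle hle.
rewrite -[2 * a]powRr1; last by rewrite mulr_ge0.
have -> : (\int[mu]_(x in D) (g x)%:E = \int[mu]_(x in D) (g x `^ 1)%:E)%E.
  by apply: eq_integral => x; rewrite inE => /g0 ?; rewrite powRr1.
exact: (powR_integral_le mD mg mh a0 N0 (lexx _) s1 DV g0 h0 gle hle).
Qed.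

Lemma Lnorm_restrict D f (u : R) : 0 < u -> (forall x, 0 <= f x) ->
  ('N[mu]_(u%:E)[EFin \o (fun x => f x * \1_D x)%R] =
   (\int[mu]_(x in D) (f x `^ u)%:E) `^ u^-1)%E.
Proof.
move=> u0 f0; rewrite unlock /Lnorm; congr (_ `^ _)%E.
rewrite [RHS]integral_mkcond; apply: eq_integral => x _ /=.
rewrite patchE indicE; case: ifPn => xD; first by rewrite mulr1 ger0_norm.
by rewrite mulr0 normr0 powR0// gt_eqF.
Qed.

(** Multiplying both functions by the indicator of D reduces this to Hölder's inequality on the
    whole space. *)
Lemma hoelder_le D f g (r r' C : R) :
  measurable D -> measurable_fun [set: T] f -> measurable_fun [set: T] g ->
  0 < r -> 0 < r' -> r^-1 + r'^-1 = 1 -> 0 <= C ->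
  (forall x, 0 <= f x) -> (forall x, 0 <= g x) ->
  (\int[mu]_(x in D) (g x `^ r')%:E <= (C `^ r')%:E)%E ->
  (\int[mu]_(x in D) (g x * f x)%:E <=
    C%:E * (\int[mu]_(x in D) (f x `^ r)%:E) `^ r^-1)%E.
Proof.
move=> mD mf mg r0 r'0 rr' C0 f0 g0 gC.
have mD1 : measurable_fun [set: T] (\1_D : T -> R) by exact: measurable_indic.
have mfD : measurable_fun [set: T] (fun x => f x * \1_D x) by exact: measurable_funM.
have mgD : measurable_fun [set: T] (fun x => g x * \1_D x) by exact: measurable_funM.
have r'r : r'^-1 + r^-1 = 1 by rewrite addrC.
have := hoelder mu mgD mfD r'0 r0 r'r.
rewrite !Lnorm_restrict// Lnorm1 => H.
have -> : (\int[mu]_(x in D) (g x * f x)%:E =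
    \int[mu]_x `|((g x * \1_D x) * (f x * \1_D x))%:E|)%E.
  rewrite integral_mkcond; apply: eq_integral => x _ /=; rewrite patchE indicE.
  case: ifPn => xD; last by rewrite !mulr0 normr0.
  by rewrite !mulr1 ger0_norm// mulr_ge0.
apply: (le_trans H); apply: lee_wpmul2r; first exact: poweR_ge0.
have -> : C%:E = (((C `^ r')%:E) `^ r'^-1)%E.
  by rewrite poweR_EFin -powRrM mulfV ?gt_eqF// powRr1.
apply: le_poweR => //; first by rewrite invr_ge0 ltW.
by apply: integral_ge0 => x _; rewrite lee_fin powR_ge0.
Qed.

End PowerIntegrals.

(** * Oscillation of CMO functions *)

Section Oscillation.
Variables (R : realType) (p : nat) (p_pr : prime p) (n : nat).
Local Notation T := (padic_space p_pr n).
Variable mu : {measure set T -> \bar R}.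
Hypothesis mu_haar : haar_measure mu.
Local Notation B := (pball p_pr n).

(** A real power, so that the factors V^(1/r) and V^(1/r') of the estimates merge into a single
    exponent of p. *)
Definition pball_vol (k : int) : R := p%:R `^ (n%:R * k%:~R).
Local Notation V := pball_vol.

Lemma pball_vol_gt0 k : 0 < V k.
Proof. by rewrite powR_gt0// ltr0n prime_gt0. Qed.

Lemma haar_pball_vol k : mu (B k) = (V k)%:E.
Proof.
rewrite (haar_pball mu_haar) /V powRrM powR_mulrn ?ler0n//.
by rewrite powR_intmul// exprn_ge0.
Qed.

Lemma pball_vol_succ k : V (k + 1) = V 1 * V k.
Proof.
rewrite /V -powRD; last by rewrite pnatr_eq0 -lt0n prime_gt0//; apply/implyP.
by congr (_ `^ _); rewrite rmorphD /=; ring.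
Qed.

Variables (s : R) (b : T -> R[i]).
Hypotheses (s_ge1 : 1 <= s) (b_CMO : CMO mu s b).

Let s0 : 0 < s. Proof. exact: lt_le_trans s_ge1. Qed.

Definition deviation (k : int) (x : T) : R := cmod (b x - paverage mu b k).

Lemma deviation_ge0 k x : 0 <= deviation k x.
Proof. exact: cmod_ge0. Qed.

Lemma cmeasurable_CMO : cmeasurable b.
Proof. by case: b_CMO => -[]. Qed.

Lemma measurable_deviation k : measurable_fun [set: T] (deviation k).
Proof.
apply: cmeasurable_cmod; apply: cmeasurableB; first exact: cmeasurable_CMO.
exact: cmeasurable_cst.
Qed.

Lemma CMO_integral_le : exists N : R, 0 < N /\
  forall k, (\int[mu]_(x in B k) (deviation k x `^ s)%:E <= (V k * N `^ s)%:E)%E.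
Proof.
have [_ foo] := b_CMO.
have X_le k : ((((V k)^-1)%:E * \int[mu]_(x in B k) (deviation k x `^ s)%:E)
    `^ s^-1 <= CMO_norm mu s b)%E.
  apply: ereal_sup_ubound; exists k => //.
  by rewrite haar_pball_vol.
have N0 : (0 <= CMO_norm mu s b)%E by apply: le_trans (X_le 0); exact: poweR_ge0.
have Nfin : CMO_norm mu s b \is a fin_num by rewrite ge0_fin_numE.
set N := fine (CMO_norm mu s b).
(* The CMO norm may be 0, while [powR_integral_le] divides by the bound; adding 1 keeps it
   positive. *)
exists (N + 1); split; first by rewrite ltr_wpDl// fine_ge0.
move=> k; set I := (\int[mu]_(x in B k) _)%E.
have I0 : (0 <= I)%E by apply: integral_ge0 => x _; rewrite lee_fin powR_ge0.
have V0 := pball_vol_gt0 k.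
have VI0 : (0 <= ((V k)^-1)%:E * I)%E by rewrite mule_ge0// lee_fin invr_ge0 ltW.
have H : (((V k)^-1)%:E * I <= ((N + 1) `^ s)%:E)%E.
  have -> : (((V k)^-1)%:E * I = ((((V k)^-1)%:E * I) `^ s^-1) `^ s)%E.
    by rewrite -poweRrM mulVf ?gt_eqF// poweRe1.
  rewrite -poweR_EFin; apply: le_poweR; rewrite ?(ltW s0) ?poweR_ge0//.
  apply: (le_trans (X_le k)); rewrite -(fineK Nfin) lee_fin lerDl ler01//.
have -> : I = ((V k)%:E * (((V k)^-1)%:E * I))%E.
  by rewrite muleA -EFinM mulfV ?gt_eqF// mul1e.
by rewrite EFinM lee_wpmul2l// lee_fin ltW.
Qed.

Lemma Lr_loc_integral_lty (f : T -> R[i]) k : Lr_loc mu s f ->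
  (\int[mu]_(x in B k) (cmod (f x))%:E < +oo)%E.
Proof.
move=> [mf /(_ k)]; set I := (\int[mu]_(x in _) _)%E => Ioo.
have I0 : (0 <= I)%E by apply: integral_ge0 => x _; rewrite lee_fin powR_ge0.
have Ifin : I \is a fin_num by rewrite ge0_fin_numE.
(* The maximum serves both as a bound for the volume and, with N = 1, as a bound for the integral of
   the s-th power. *)
apply: (@le_lt_trans _ _ (Num.max (V k) (fine I) * (2 * 1))%:E); last exact: ltry.
apply: (@integral_le_powR _ _ _ mu (B k) _ (fun x => cmod (f x)) 1 1 _ s) => //.
- exact: measurable_pball.
- exact: cmeasurable_cmod.
- exact: cmeasurable_cmod.
- by rewrite haar_pball_vol lee_fin le_max lexx.
- by move=> x _; exact: cmod_ge0.
- by move=> x; exact: cmod_ge0.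
- by move=> x _; rewrite divr1 mul1r le_max lexx orbT.
- by rewrite powR1 mulr1 -/I -[leLHS](fineK Ifin) lee_fin le_max lexx orbT.
Qed.

Lemma cmod_paverageB_le (c : R[i]) k :
  ((cmod (paverage mu b k - c))%:E <=
    (2 / V k)%:E * \int[mu]_(x in B k) (cmod (b x - c))%:E)%E.
Proof.
have mB : measurable (B k) := measurable_pball k.
have mb := cmeasurable_CMO; have V0 := pball_vol_gt0 k.
have ib : cintegrable mu (B k) b.
  by apply: cmod_integrable => //; apply: Lr_loc_integral_lty; case: b_CMO.
have ic (a : R[i]) : cintegrable mu (B k) (fun=> a).
  apply: cmod_integrable => //.
  by rewrite integral_cst// haar_pball_vol -EFinM ltry.
have -> : paverage mu b k - c =
    ((V k)^-1)%:C%C * cintegral mu (B k) (fun x => b x - c).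
  rewrite /paverage haar_pball_vol /= (cintegralD mB ib (ic (- c))) mulrDr.
  congr (_ + _); rewrite /cintegral !Rintegral_cst// haar_pball_vol /=.
  case: c => x y; simpc.
  by rewrite ![_ * V k]mulrC !mulrA mulVf ?gt_eqF// !mul1r.
rewrite cmodM cmod_real ger0_norm ?invr_ge0 ?(ltW V0)// EFinM (mulrC 2) EFinM.
rewrite -muleA lee_wpmul2l ?lee_fin ?invr_ge0 ?(ltW V0)//.
apply: cmod_cintegral_le => //.
by apply: cmeasurableB => //; exact: cmeasurable_cst.
Qed.

Lemma paverage_succ : exists M : R, 0 < M /\
  forall k, cmod (paverage mu b k - paverage mu b (k + 1)) <= M.
Proof.
have [N [N0 NP]] := CMO_integral_le.
(* One factor 2 comes from [cmod_paverageB_le], the other from [integral_le_powR]; V 1 = p^n is the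
   ratio of the volumes of consecutive balls. *)
exists (4 * V 1 * N); split; first by rewrite !mulr_gt0// pball_vol_gt0.
move=> k; have V0 := pball_vol_gt0 k.
rewrite -lee_fin; apply: (le_trans (cmod_paverageB_le _ _)).
apply: (@le_trans _ _ ((2 / V k)%:E *
    \int[mu]_(x in B (k + 1)) (deviation (k + 1) x)%:E)%E).
  apply: lee_wpmul2l; first by rewrite lee_fin divr_ge0// ltW.
  apply: ge0_subset_integral.
  - exact: measurable_pball.
  - exact: measurable_pball.
  - by apply/measurable_EFinP; apply: measurable_funS (measurable_deviation _).
  - by move=> x _; rewrite lee_fin deviation_ge0.
  - by apply: sub_pball; lia.
apply: (@le_trans _ _ ((2 / V k)%:E * (V (k + 1) * (2 * N))%:E)%E).
  apply: lee_wpmul2l; first by rewrite lee_fin divr_ge0// ltW.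
  apply: (@integral_le_powR _ _ _ mu (B (k + 1)) _ (deviation (k + 1)) N N _ s) => //.
  - exact: measurable_pball.
  - exact: measurable_deviation.
  - exact: measurable_deviation.
  - exact: ltW.
  - by rewrite haar_pball_vol.
  - by move=> x _; exact: deviation_ge0.
  - exact: deviation_ge0.
  - move=> x _; rewrite -ler_pdivrMl// mulrC.
    by rewrite le_max lexx orbT.
rewrite -EFinM lee_fin.
rewrite pball_vol_succ le_eqVlt; apply/orP; left; apply/eqP; field.
by rewrite gt_eqF.
Qed.

(** Telescoping over consecutive balls. The growth is linear in the exponent, hence logarithmic in
    the radius, as for the means of BMO functions. *)
Lemma paverage_dist : exists M : R, 0 < M /\
  forall k j, cmod (paverage mu b j - paverage mu b k) <= M * `|k - j|%N%:R.
Proof.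
have [M [M0 MP]] := paverage_succ; exists M; split => //.
have up k (m : nat) : cmod (paverage mu b k - paverage mu b (k + m%:Z)) <= M * m%:R.
  elim: m => [|m IH].
    by rewrite addr0 subrr mulr0 (cmod_real (R := R) 0) normr0.
  rewrite -(subrKA (paverage mu b (k + m%:Z))) (le_trans (cmodD _ _))//.
  rewrite -natr1 mulrDr mulr1 lerD// (_ : k + m.+1%:Z = k + m%:Z + 1)//.
  by rewrite -addrA; congr (_ + _); lia.
move=> k j; have [jk|kj] := leP j k.
  have {1}-> : k = j + `|k - j|%N%:Z by lia.
  exact: up.
rewrite -opprB cmodN; have {1}-> : j = k + `|k - j|%N%:Z by lia.
exact: up.
Qed.

Lemma deviation_integral_le : exists D : R, 0 < D /\ forall (k j : int) (u : R),
  1 <= u -> u <= s ->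
  (\int[mu]_(x in B j) ((1 + deviation k x) `^ u)%:E <=
    (V j * (D * (1 + `|k - j|%N%:R)) `^ u)%:E)%E.
Proof.
have [N [N0 NP]] := CMO_integral_le; have [M [M0 MP]] := paverage_dist.
(* Since deviation_k <= deviation_j + M |k-j| and deviation_j <= N max(1, deviation_j / N), the
   comparison holds with a = (1 + M + N)(1 + |k-j|); the 2 is that of [powR_integral_le]. *)
exists (2 * (1 + M + N)); split; first by rewrite mulr_gt0// !addr_gt0.
move=> k j u u1 us; set m := `|k - j|%N%:R.
have m0 : 0 <= m by exact: ler0n.
rewrite -mulrA; apply: (@powR_integral_le _ _ _ mu (B j) (fun x => 1 + deviation k x)
   (deviation j) _ N (V j) s u) => //.
- exact: measurable_pball.
- by apply: measurable_funD => //; exact: measurable_deviation.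
- exact: measurable_deviation.
- by rewrite mulr_ge0 ?addr_ge0// ltW.
- by rewrite haar_pball_vol.
- by move=> x _; rewrite addr_ge0 ?deviation_ge0.
- exact: deviation_ge0.
move=> x _; set y := Num.max _ _.
have y1 : 1 <= y by rewrite le_max lexx.
have dN : deviation j x <= N * y.
  by rewrite -ler_pdivrMl// mulrC le_max lexx orbT.
have dk : deviation k x <= deviation j x + M * m.
  rewrite /deviation -(subrKA (paverage mu b j)) (le_trans (cmodD _ _))//.
  by rewrite lerD.
apply: (@le_trans _ _ (1 + (N * y + M * m))).
  by rewrite lerD2l (le_trans dk)// lerD2r.
have my : M * m <= M * (m * y) by rewrite ler_wpM2l ?(ltW M0)// ler_peMr.
have y0 : 0 <= y := le_trans ler01 y1.
have m1 : 0 <= m * y by rewrite mulr_ge0.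
have m2 : 0 <= M * y by rewrite mulr_ge0// ltW.
have m3 : 0 <= N * (m * y) by rewrite mulr_ge0// ltW.
by nra.
Qed.

End Oscillation.

(** * Commutators with radial kernels *)

(** With rho = t^2, one of the two factors t^m absorbs the linear term: Bernoulli's inequality gives
    1 + m x <= t^(-m) for x = 1/t - 1. *)
Lemma linear_geometric_le (R : realType) (rho : R) : 0 < rho < 1 ->
  exists t C : R, [/\ 0 < t < 1, 0 <= C &
    forall m : nat, (1 + m%:R) * rho ^+ m <= C * t ^+ m].
Proof.
move=> /andP[r0 r1]; pose t := Num.sqrt rho.
have t0 : 0 < t by rewrite sqrtr_gt0.
have t1 : t < 1 by rewrite -[ltRHS]sqrtr1 ltr_sqrt.
have tt : t * t = rho by rewrite -expr2 sqr_sqrtr// ltW.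
pose x := t^-1 - 1; have x0 : 0 < x by rewrite subr_gt0 invf_gt1.
exists t, (1 + x^-1); split; first by rewrite t0.
  by rewrite addr_ge0// invr_ge0 ltW.
move=> m; rewrite -tt exprMn mulrA ler_wpM2r ?exprn_ge0 ?(ltW t0)//.
have bernoulli : 1 + m%:R * x <= t^-1 ^+ m.
  have -> : t^-1 = 1 + x by rewrite /x addrC subrK.
  elim: m => [|m IH]; first by rewrite mul0r addr0 expr0.
  rewrite exprS -natr1; apply: (@le_trans _ _ ((1 + x) * (1 + m%:R * x))).
    have : 0 <= m%:R * (x * x) by rewrite mulr_ge0// mulr_ge0// ltW.
    by nra.
  by rewrite ler_wpM2l// addr_ge0// ltW.
apply: (@le_trans _ _ ((1 + x^-1) * (1 + m%:R * x) * t ^+ m)).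
  rewrite ler_wpM2r ?exprn_ge0 ?(ltW t0)//.
  have -> : (1 + x^-1) * (1 + m%:R * x) = 1 + m%:R + (m%:R * x + x^-1).
    by field; rewrite gt_eqF.
  by rewrite lerDl addr_ge0 ?invr_ge0 ?mulr_ge0// ltW.
rewrite -[leRHS]mulr1 -mulrA ler_wpM2l ?addr_ge0 ?invr_ge0 ?(ltW x0)//.
apply: (@le_trans _ _ (t^-1 ^+ m * t ^+ m)).
  by rewrite ler_wpM2r ?exprn_ge0 ?(ltW t0).
by rewrite -exprMn mulVf ?gt_eqF// expr1n.
Qed.

Section KernelCommutator.
Variables (R : realType) (p : nat) (p_pr : prime p) (n : nat).
Hypothesis n_gt0 : (0 < n)%N.
Local Notation T := (padic_space p_pr n).
Variable mu : {measure set T -> \bar R}.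
Hypothesis mu_haar : haar_measure mu.
Local Notation B := (pball p_pr n).
Local Notation S := (psphere p_pr n).
Local Notation V := (@pball_vol R p n).

Variables (r r' s : R) (b : T -> R[i]).
Hypotheses (r_gt1 : 1 < r) (r'_gt1 : 1 < r') (rr' : r^-1 + r'^-1 = 1).
Hypotheses (rs : r <= s) (r's : r' <= s) (b_CMO : CMO mu s b).
Local Notation beta := (deviation mu b).

(** On S_k the operator integrates f against [w k] over [W k], and [K k j] bounds this kernel on
    S_j. For [hardy] these are B_k and the constant 1/|B_k|, for [hardy_star] the complement of B_k
    and |t|^(-n). The formula for [A] is assumed only where the integral converges, so that the
    factor outside the integral in [hardy] may be moved inside. *)
Variables (W : int -> set T) (w : int -> T -> R) (K : int -> int -> R).
Hypothesis mW : forall k, measurable (W k).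
Hypothesis mw : forall k, measurable_fun [set: T] (w k).
Hypothesis w_ge0 : forall k t, 0 <= w k t.
Hypothesis K_ge0 : forall k j, 0 <= K k j.
Hypothesis wK : forall k j t, W k t -> S j t -> w k t <= K k j.

Variable A : (T -> R[i]) -> T -> R[i].
Hypothesis AE : forall f x, x != 0 ->
  cintegrable mu (W (level x)) (fun t => (w (level x) t)%:C%C * f t) ->
  A f x = cintegral mu (W (level x)) (fun t => (w (level x) t)%:C%C * f t).
Hypothesis A_radial : forall f x y,
  x != 0 -> y != 0 -> level x = level y -> A f x = A f y.

Let r0 : 0 < r. Proof. exact: lt_trans r_gt1. Qed.
Let r'0 : 0 < r'. Proof. exact: lt_trans r'_gt1. Qed.
Let s1 : 1 <= s. Proof. exact: le_trans (ltW r_gt1) rs. Qed.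
Let mbeta k : measurable_fun [set: T] (beta k).
Proof. exact: (measurable_deviation b_CMO). Qed.
Let mb : cmeasurable b. Proof. exact: (cmeasurable_CMO b_CMO). Qed.

Definition sphere_norm (f : T -> R[i]) (k : int) : \bar R :=
  ((\int[mu]_(x in S k) (cmod (f x) `^ r)%:E) `^ r^-1)%E.

(** Dominates the kernel integrals of |f|, of |(b - b_k) f| and, up to a constant depending on k, of
    |b f|, where b_k is the mean of b over B_k. *)
Definition kernel_majorant (f : T -> R[i]) (k : int) : \bar R :=
  (\int[mu]_(t in W k) (w k t * ((1 + beta k t) * cmod (f t)))%:E)%E.
Local Notation Theta := kernel_majorant.

Lemma sphere_norm_ge0 f k : (0 <= sphere_norm f k)%E.
Proof. exact: poweR_ge0. Qed.

Lemma kernel_majorant_ge0 f k : (0 <= Theta f k)%E.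
Proof.
apply: integral_ge0 => x _.
by rewrite lee_fin !mulr_ge0 ?addr_ge0 ?cmod_ge0.
Qed.

Let mbf k f : cmeasurable f ->
  measurable_fun [set: T] (fun t => (1 + beta k t) * cmod (f t)).
Proof.
move=> mf; apply: measurable_funM; last exact: cmeasurable_cmod.
by apply: measurable_funD => //; exact: mbeta.
Qed.

(** On each sphere the kernel is replaced by its bound and Hölder puts the exponent r' on
    [1 + beta k]; here r' <= s is used. The sphere S_j is enlarged to B_j, where the oscillation of
    b is controlled. *)
Lemma kernel_majorant_le : exists D : R, 0 < D /\ forall f k, cmeasurable f ->
  (Theta f k <= \esum_(j in [set: int])
    (D * (1 + `|k - j|%N%:R) * K k j * V j `^ r'^-1)%:E * sphere_norm f j)%E.
Proof.
have [D [D0 DP]] := deviation_integral_le mu_haar s1 b_CMO.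
exists D; split => // f k mf; rewrite /Theta (integral_spheres mu_haar)//; first last.
- by move=> x _; rewrite lee_fin !mulr_ge0 ?addr_ge0 ?cmod_ge0.
- apply/measurable_EFinP; apply: (measurable_funS measurableT) => //.
  by apply: measurable_funM => //; exact: mbf.
apply: le_esum => j _.
have V0 := @pball_vol_gt0 R _ p_pr n j.
have mS : measurable (S j) := measurable_psphere j.
have mWS : measurable (W k `&` S j) by exact: measurableI.
have D10 : 0 <= D * (1 + `|k - j|%N%:R) by rewrite mulr_ge0 ?addr_ge0// ltW.
have H : (\int[mu]_(t in S j) ((1 + beta k t) * cmod (f t))%:E <=
    (V j `^ r'^-1 * (D * (1 + `|k - j|%N%:R)))%:E * sphere_norm f j)%E.
  apply: (@hoelder_le _ _ _ mu _ _ _ r r') => //.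
  - exact: cmeasurable_cmod.
  - by apply: measurable_funD => //; exact: mbeta.
  - by rewrite mulr_ge0// powR_ge0.
  - by move=> x; exact: cmod_ge0.
  - by move=> x; rewrite addr_ge0 ?cmod_ge0.
  rewrite powRM ?powR_ge0// -powRrM mulVf ?gt_eqF// powRr1 ?(ltW V0)//.
  apply: le_trans (DP k j r' (ltW r'_gt1) r's).
  apply: ge0_subset_integral => //.
  - exact: measurable_pball.
  - apply: (measurable_EFin_powR _ (measurable_pball j)).
    by apply: measurable_funD => //; exact: mbeta.
  - by move=> x _; rewrite lee_fin powR_ge0.
  - exact: psphere_sub_pball.
apply: (@le_trans _ _ ((K k j)%:E *
    \int[mu]_(t in S j) ((1 + beta k t) * cmod (f t))%:E)%E); last first.
  apply: (le_trans (lee_wpmul2l _ H)); first by rewrite lee_fin.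
  rewrite muleA -EFinM le_eqVlt; apply/orP; left; apply/eqP.
  by congr (_%:E * _)%E; ring.
have mg : measurable_fun (S j) (fun t => ((1 + beta k t) * cmod (f t))%:E).
  by apply/measurable_EFinP; apply: (measurable_funS measurableT) (mbf _ mf).
have g0 t : (0 <= ((1 + beta k t) * cmod (f t))%:E)%E.
  by rewrite lee_fin mulr_ge0 ?addr_ge0 ?cmod_ge0.
rewrite -ge0_integralZl//; last by rewrite lee_fin.
apply: (@le_trans _ _ (\int[mu]_(t in W k `&` S j)
    ((K k j)%:E * ((1 + beta k t) * cmod (f t))%:E))%E).
  apply: ge0_le_integral => //.
  - by move=> t _; rewrite lee_fin !mulr_ge0 ?addr_ge0 ?cmod_ge0.
  - apply/measurable_EFinP; apply: (measurable_funS measurableT) => //.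
    by apply: measurable_funM => //; exact: mbf.
  - apply: emeasurable_funM => //; apply: measurable_funS mg => //.
  - move=> t [Wt St]; rewrite -EFinM lee_fin ler_wpM2r// ?wK//.
    by rewrite mulr_ge0 ?addr_ge0 ?cmod_ge0.
apply: ge0_subset_integral => //.
- by apply: emeasurable_funM.
- by move=> t _; rewrite mule_ge0// lee_fin.
Qed.

Lemma kernel_integral_le f g k (c : R) : cmeasurable f -> cmeasurable g ->
  0 <= c -> (forall t, cmod (g t) <= c * ((1 + beta k t) * cmod (f t))) ->
  (\int[mu]_(t in W k) (cmod ((w k t)%:C%C * g t))%:E <= c%:E * Theta f k)%E.
Proof.
move=> mf mg c0 gf; rewrite -ge0_integralZl//; last 2 first.
- apply/measurable_EFinP; apply: (measurable_funS measurableT) => //.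
  by apply: measurable_funM => //; exact: mbf.
- by move=> t _; rewrite lee_fin !mulr_ge0 ?addr_ge0 ?cmod_ge0.
apply: ge0_le_integral => //.
- by move=> t _; rewrite lee_fin cmod_ge0.
- apply/measurable_EFinP; apply: (measurable_funS measurableT) => //.
  apply: cmeasurable_cmod; apply: cmeasurableM => //.
  exact: cmeasurable_real.
- apply: emeasurable_funM => //; apply/measurable_EFinP.
  apply: (measurable_funS measurableT) => //.
  by apply: measurable_funM => //; exact: mbf.
- move=> t _; rewrite -EFinM lee_fin cmodM cmod_real ger0_norm//.
  by rewrite mulrCA ler_wpM2l.
Qed.

Let mbd k f : cmeasurable f ->
  cmeasurable (fun t => (b t - paverage mu b k) * f t).
Proof.
move=> mf; apply: cmeasurableM => //; apply: cmeasurableB => //.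
Qed.

Lemma kernel_integrable f k : cmeasurable f -> (Theta f k < +oo)%E ->
  [/\ cintegrable mu (W k) (fun t => (w k t)%:C%C * f t),
    cintegrable mu (W k) (fun t => (w k t)%:C%C * ((b t - paverage mu b k) * f t)) &
    cintegrable mu (W k) (fun t => (w k t)%:C%C * (b t * f t))].
Proof.
move=> mf foo.
have mwf g : cmeasurable g -> cmeasurable (fun t => (w k t)%:C%C * g t).
  by move=> mg; apply: cmeasurableM => //; exact: cmeasurable_real.
have H g (c : R) : cmeasurable g -> 0 <= c ->
    (forall t, cmod (g t) <= c * ((1 + beta k t) * cmod (f t))) ->
    cintegrable mu (W k) (fun t => (w k t)%:C%C * g t).
  move=> mg c0 gf; apply: cmod_integrable => //; first exact: mwf.
  apply: (le_lt_trans (kernel_integral_le mf mg c0 gf)).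
  have fT : Theta f k \is a fin_num by rewrite ge0_fin_numE ?kernel_majorant_ge0.
  by rewrite -(fineK fT) -EFinM ltry.
split; [apply: (H _ 1)|apply: (H _ 1)|apply: (H _ (1 + cmod (paverage mu b k)))] => //.
- by move=> t; rewrite mul1r ler_peMl ?cmod_ge0// lerDl deviation_ge0.
- exact: mbd.
- by move=> t; rewrite mul1r cmodM ler_wpM2r ?cmod_ge0// lerDr.
- exact: cmeasurableM.
- by rewrite addr_ge0 ?cmod_ge0.
(* |b| <= |b - b_k| + |b_k| <= (1 + |b_k|)(1 + beta_k). The constant depends on k, which is harmless
   because only finiteness is at stake. *)
- move=> t; rewrite cmodM mulrA ler_wpM2r ?cmod_ge0//.
  rewrite -{1}(subrK (paverage mu b k) (b t)) (le_trans (cmodD _ _))//.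
  rewrite -/(beta k t); have := deviation_ge0 mu b k t.
  have := cmod_ge0 (paverage mu b k); nra.
Qed.

Lemma commutator_le f x : cmeasurable f -> x != 0 ->
  (Theta f (level x) < +oo)%E ->
  cmod (commutator A b f x) <= 2 * fine (Theta f (level x)) * (1 + beta (level x) x).
Proof.
move=> mf x0; set k := level x => foo.
have [i1 i2 i3] := kernel_integrable mf foo.
have fT : Theta f k \is a fin_num by rewrite ge0_fin_numE ?kernel_majorant_ge0.
have mwf g : cmeasurable g -> cmeasurable (fun t => (w k t)%:C%C * g t).
  by move=> mg; apply: cmeasurableM => //; exact: cmeasurable_real.
pose c := paverage mu b k; pose I g := cintegral mu (W k) (fun t => (w k t)%:C%C * g t).
have -> : commutator A b f x = (b x - c) * I f - I (fun t => (b t - c) * f t).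
  rewrite /commutator (AE x0 i1) (AE x0 i3) -/k -/(I f).
  (* Splitting b f = (b - c) f + c f under the integral uses the convergence of both pieces. *)
  have -> : cintegral mu (W k) (fun t => (w k t)%:C%C * (b t * f t)) =
      I (fun t => (b t - c) * f t) + c * I f.
    rewrite -(cintegralZl c (mW k) i1) -(cintegralD (mW k) i2); last exact: cintegrableZl.
    by congr (cintegral mu (W k) _); apply/funext => t; rewrite /c; ring.
  by ring.
have H g : cmeasurable g ->
    (forall t, cmod (g t) <= 1 * ((1 + beta k t) * cmod (f t))) ->
    cmod (I g) <= 2 * fine (Theta f k).
  move=> mg gf; rewrite -lee_fin EFinM fineK//.
  apply: (le_trans (cmod_cintegral_le mu (mW k) (mwf g mg))).
  apply: lee_wpmul2l; first by rewrite lee_fin.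
  by rewrite -[leRHS]mul1e; exact: kernel_integral_le.
rewrite (le_trans (cmodB _ _))// mulrDr mulr1 addrC lerD//.
  apply: H; first exact: mbd.
  by move=> t; rewrite mul1r cmodM ler_wpM2r ?cmod_ge0// lerDr.
rewrite cmodM mulrC ler_wpM2r ?cmod_ge0//; apply: H => //.
by move=> t; rewrite mul1r ler_peMl ?cmod_ge0// lerDl deviation_ge0.
Qed.

Lemma cmeasurable_kernel f : cmeasurable (A f).
Proof. by apply: cmeasurable_radial; exact: A_radial. Qed.

Lemma cmeasurable_commutator f : cmeasurable (commutator A b f).
Proof.
apply: cmeasurableB; last exact: cmeasurable_kernel.
by apply: cmeasurableM => //; exact: cmeasurable_kernel.
Qed.

(** In [commutator_le] the majorant is constant on S_k and leaves the integral. What remains is the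
    L^r norm of [1 + beta k] over B_k, the case j = k of [deviation_integral_le]; here r <= s is
    used. *)
Lemma commutator_sphere_norm_le : exists D : R, 0 < D /\ forall f k,
  cmeasurable f -> (Theta f k < +oo)%E ->
  (sphere_norm (commutator A b f) k <= (D * V k `^ r^-1)%:E * Theta f k)%E.
Proof.
have [D [D0 DP]] := deviation_integral_le mu_haar s1 b_CMO.
exists (2 * D); split; first by rewrite mulr_gt0.
move=> f k mf foo.
have fT : Theta f k \is a fin_num by rewrite ge0_fin_numE ?kernel_majorant_ge0.
set th := fine (Theta f k); have th0 : 0 <= th by rewrite fine_ge0 ?kernel_majorant_ge0.
have V0 := @pball_vol_gt0 R _ p_pr n k.
have m1b : measurable_fun [set: T] (fun x => 1 + beta k x).
  by apply: measurable_funD => //; exact: mbeta.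
have mS : measurable (S k) := measurable_psphere k.
have H : (\int[mu]_(x in S k) (cmod (commutator A b f x) `^ r)%:E <=
   (((2 * th) `^ r) * (V k * D `^ r))%:E)%E.
  apply: (@le_trans _ _ (\int[mu]_(x in S k)
      (((2 * th) `^ r)%:E * ((1 + beta k x) `^ r)%:E))%E).
    apply: ge0_le_integral => //.
    - by move=> x _; rewrite lee_fin powR_ge0.
    - apply: measurable_EFin_powR => //.
      exact: (cmeasurable_cmod (cmeasurable_commutator f)).
    - by apply: emeasurable_funM => //; exact: measurable_EFin_powR.
    - move=> x /psphereE[x0 xk]; have b0 := deviation_ge0 mu b k x.
      rewrite -EFinM lee_fin -powRM; [|by rewrite mulr_ge0|by rewrite addr_ge0].
      apply: ge0_ler_powR; rewrite ?nnegrE ?cmod_ge0 ?(ltW r0)//.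
        by rewrite mulr_ge0 ?addr_ge0// mulr_ge0.
      by have := commutator_le mf x0; rewrite xk; exact.
  rewrite ge0_integralZl//; last 3 first.
  - exact: measurable_EFin_powR.
  - by move=> x _; rewrite lee_fin powR_ge0.
  - by rewrite lee_fin powR_ge0.
  rewrite EFinM; apply: lee_wpmul2l; first by rewrite lee_fin powR_ge0.
  apply: (@le_trans _ _ (\int[mu]_(x in B k) ((1 + beta k x) `^ r)%:E)%E).
    apply: ge0_subset_integral => //.
    - exact: measurable_pball.
    - exact: (measurable_EFin_powR _ (measurable_pball k)).
    - by move=> x _; rewrite lee_fin powR_ge0.
    - exact: psphere_sub_pball.
  by have := DP k k r (ltW r_gt1) rs; rewrite subrr addr0 mulr1.
rewrite -(fineK fT) -/th -EFinM.
have -> : 2 * D * V k `^ r^-1 * th = (((2 * th) `^ r) * (V k * D `^ r)) `^ r^-1.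
  rewrite !powRM ?mulr_ge0 ?powR_ge0 ?(ltW D0) ?(ltW V0)//.
  by rewrite -!powRrM mulfV ?gt_eqF// !powRr1 ?(ltW D0)//; ring.
rewrite -poweR_EFin; apply: le_poweR => //; first by rewrite invr_ge0 ltW.
by apply: integral_ge0 => x _; rewrite lee_fin powR_ge0.
Qed.

(** A Schur-type test with a free weight, since it serves both for the Herz weight and for the
    truncated weight behind local integrability. *)
Lemma commutator_weighted_le (phi : int -> R) (rho q : R) :
  (forall k, 0 < phi k) -> 0 < rho < 1 -> 0 < q ->
  (forall k j, phi k * V k `^ r^-1 * K k j * V j `^ r'^-1 <=
     rho ^+ `|k - j|%N * phi j) ->
  exists C : R, 0 <= C /\ forall f, cmeasurable f ->
    (\esum_(j in [set: int]) ((phi j)%:E * sphere_norm f j) `^ q < +oo)%E ->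
    (forall k, (Theta f k < +oo)%E) /\
    (\esum_(k in [set: int])
        ((phi k)%:E * sphere_norm (commutator A b f) k) `^ q <=
      C%:E * \esum_(j in [set: int]) ((phi j)%:E * sphere_norm f j) `^ q)%E.
Proof.
move=> phi0 rho01 q0 schur.
have [D1 [D10 D1P]] := kernel_majorant_le.
have [t [C1 [t01 C10 C1P]]] := linear_geometric_le rho01.
have [C2 [C20 C2P]] := esum_geometric_convolution t01 q0.
have [D2 [D20 D2P]] := commutator_sphere_norm_le.
have t0 : 0 < t by case/andP: t01.
exists ((D2 * (D1 * C1)) `^ q * C2); split; first by rewrite mulr_ge0// powR_ge0.
move=> f mf; set u := fun j => ((phi j)%:E * sphere_norm f j)%E => uoo.
have u0 j : (0 <= u j)%E by rewrite mule_ge0 ?sphere_norm_ge0// lee_fin ltW.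
pose conv k := (\esum_(j in [set: int]) ((t ^+ `|k - j|%N)%:E * u j))%E.
have tm0 m : 0 <= t ^+ m by rewrite exprn_ge0// ltW.
have conv0 k : (0 <= conv k)%E by apply: esum_ge0 => j _; rewrite mule_ge0// lee_fin.
(* The factor of the Schur hypothesis that depends on k alone; multiplying by it brings the
   coefficients of [kernel_majorant_le] into the form of that hypothesis. *)
pose X k := phi k * V k `^ r^-1.
have X0 k : 0 < X k by rewrite mulr_gt0// powR_gt0// pball_vol_gt0.
have Tle k : (Theta f k <= ((X k)^-1 * (D1 * C1))%:E * conv k)%E.
  have c0 : 0 <= (X k)^-1 * (D1 * C1).
    by apply: mulr_ge0; [rewrite invr_ge0 ltW|rewrite mulr_ge0// ltW].
  apply: (le_trans (D1P f k mf)); apply: le_trans (esum_mull_le _ _); last first.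
  - by move=> j _; rewrite mule_ge0// lee_fin.
  - by rewrite lee_fin.
  apply: le_esum => j _; rewrite /u !muleA -!EFinM.
  apply: lee_wpmul2r; first exact: sphere_norm_ge0.
  rewrite lee_fin; set m := `|k - j|%N.
  rewrite -(ler_pM2l (X0 k)).
  have -> : X k * ((X k)^-1 * (D1 * C1) * t ^+ m * phi j) =
      D1 * (C1 * t ^+ m) * phi j by field; rewrite gt_eqF.
  have -> : X k * (D1 * (1 + m%:R) * K k j * V j `^ r'^-1) =
      D1 * (1 + m%:R) * (X k * K k j * V j `^ r'^-1) by ring.
  apply: (@le_trans _ _ (D1 * (1 + m%:R) * (rho ^+ m * phi j))).
    by apply: ler_wpM2l; [rewrite mulr_ge0 ?addr_ge0// ltW|exact: schur].
  have -> : D1 * (1 + m%:R) * (rho ^+ m * phi j) =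
      D1 * ((1 + m%:R) * rho ^+ m) * phi j by ring.
  by rewrite ler_wpM2r ?(ltW (phi0 j))// ler_wpM2l ?(ltW D10)// C1P.
(* Finiteness of the majorant at every k must precede the norm estimate, whose pointwise step
   assumes it. It follows because a single [conv k ^ q] is at most the finite sum over all k. *)
have convoo k : (conv k < +oo)%E.
  apply: (@lty_poweRy _ _ q); first by rewrite gt_eqF.
  apply: (le_lt_trans (esum_term_le (fun k => conv k `^ q)%E k)).
  apply: (le_lt_trans (C2P u u0)).
  have fu : (\esum_(j in [set: int]) u j `^ q)%E \is a fin_num.
    by rewrite ge0_fin_numE//; apply: esum_ge0 => j _; exact: poweR_ge0.
  by rewrite -(fineK fu) -EFinM ltry.
have Too k : (Theta f k < +oo)%E.
  apply: (le_lt_trans (Tle k)).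
  have fc : conv k \is a fin_num by rewrite ge0_fin_numE.
  by rewrite -(fineK fc) -EFinM ltry.
split=> //.
have DC0 : 0 <= D2 * (D1 * C1).
  by apply: mulr_ge0; [rewrite ltW|rewrite mulr_ge0// ltW].
apply: (@le_trans _ _ (\esum_(k in [set: int])
    (((D2 * (D1 * C1)) `^ q)%:E * conv k `^ q))%E).
  apply: le_esum => k _; rewrite -poweR_EFin -poweRM ?lee_fin//.
  apply: le_poweR; first exact: ltW.
    by rewrite mule_ge0 ?sphere_norm_ge0// lee_fin ltW.
  apply: (@le_trans _ _ ((phi k)%:E * ((D2 * V k `^ r^-1)%:E * Theta f k))%E).
    by apply: lee_wpmul2l; [rewrite lee_fin ltW|exact: D2P].
  rewrite muleA -EFinM.
  apply: (@le_trans _ _ ((D2 * X k)%:E * (((X k)^-1 * (D1 * C1))%:E * conv k))%E).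
    rewrite (_ : phi k * (D2 * V k `^ r^-1) = D2 * X k); last by rewrite /X; ring.
    by apply: lee_wpmul2l => //; rewrite lee_fin mulr_ge0// ltW.
  rewrite muleA -EFinM le_eqVlt; apply/orP; left; apply/eqP.
  by congr (_%:E * _)%E; field; rewrite gt_eqF.
apply: (le_trans (esum_mull_le _ _)).
- by rewrite lee_fin powR_ge0.
- by move=> k _; exact: poweR_ge0.
rewrite EFinM -muleA; apply: lee_wpmul2l; first by rewrite lee_fin powR_ge0.
exact: C2P.
Qed.

End KernelCommutator.

(** * Herz norms *)

Lemma powR_lt1_lt0 (R : realType) (a x : R) : 1 < a -> x < 0 -> a `^ x < 1.
Proof.
move=> a1 x0; have a0 : 0 < a by exact: lt_trans a1.
by rewrite /powR gt_eqF// expR_lt1 pmulr_llt0// ln_gt0.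
Qed.

Section HerzNorm.
Variables (R : realType) (p : nat) (p_pr : prime p) (n : nat).
Local Notation T := (padic_space p_pr n).
Variable mu : {measure set T -> \bar R}.
Implicit Type f : T -> R[i].

Lemma Lr_norm_sphere (r : R) f k : 0 < r ->
  Lr_norm mu r (fun x => f x * (\1_(psphere p_pr n k) x)%:C%C) = sphere_norm mu r f k.
Proof.
move=> r0; rewrite /Lr_norm /sphere_norm.
rewrite -(Lnorm_restrict mu (psphere p_pr n k) r0) => [|x]; last exact: cmod_ge0.
apply: eq_Lnorm => x /=; rewrite cmodM cmod_real ger0_norm//.
Qed.

Lemma herz_normE (alpha q r : R) f : 0 < r ->
  herz_norm mu alpha q r f =
  ((\esum_(k in [set: int])
    ((p%:R `^ (k%:~R * alpha))%:E * sphere_norm mu r f k) `^ q) `^ q^-1)%E.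
Proof.
move=> r0; rewrite /herz_norm; congr (_ `^ _)%E; apply: eq_esum => k _.
rewrite Lr_norm_sphere// [RHS]poweRM ?sphere_norm_ge0 ?lee_fin ?powR_ge0//.
by rewrite poweR_EFin -powRrM.
Qed.

Lemma herz_sum_lty (alpha q r : R) f : 0 < q -> 0 < r ->
  (herz_norm mu alpha q r f < +oo)%E ->
  (\esum_(k in [set: int])
    ((p%:R `^ (k%:~R * alpha))%:E * sphere_norm mu r f k) `^ q < +oo)%E.
Proof.
move=> q0 r0; rewrite herz_normE// => H.
by apply: lty_poweRy H; rewrite invr_neq0// gt_eqF.
Qed.

Hypotheses (n_gt0 : (0 < n)%N) (mu_haar : haar_measure mu).

Lemma sphere_norm_powR (r : R) f k : 0 < r ->
  (sphere_norm mu r f k `^ r =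
   \int[mu]_(x in psphere p_pr n k) (cmod (f x) `^ r)%:E)%E.
Proof.
move=> r0; rewrite /sphere_norm -poweRrM mulVf ?gt_eqF// poweRe1//.
by apply: integral_ge0 => x _; rewrite lee_fin powR_ge0.
Qed.

(* A weight that is 1 near the origin and decays faster than the Herz weight
   at infinity: it turns local [L^r] integrability into a weighted sum. *)
Lemma herz_truncated_sum_lty (alpha a0 q r : R) f : 0 < q -> 0 < r -> a0 < alpha ->
  herz mu alpha q r f ->
  (\esum_(k in [set: int])
    ((p%:R `^ (a0 * (Num.max k 0)%:~R))%:E * sphere_norm mu r f k) `^ r < +oo)%E.
Proof.
move=> q0 r0 a0a [[mf floc] fherz].
have p1 : 1 < (p%:R : R) by rewrite ltr1n prime_gt1.
have p0 : 0 < (p%:R : R) by exact: lt_trans p1.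
have Soo := herz_sum_lty q0 r0 fherz; set u := fun k => _ in Soo.
set S := (\esum_(k in [set: int]) _)%E in Soo.
have S0 : (0 <= S)%E by apply: esum_ge0 => j _; exact: poweR_ge0.
have SH0 : (0 <= S `^ q^-1)%E by exact: poweR_ge0.
have Hfin : (S `^ q^-1)%E \is a fin_num.
  by rewrite ge0_fin_numE// poweR_lty.
set H := fine (S `^ q^-1)%E; have H0 : 0 <= H by rewrite fine_ge0.
(* A single term is at most the whole Herz sum, so the sphere norms are at most p^(-k alpha) times
   the Herz norm. *)
have Fle k : (sphere_norm mu r f k <= (p%:R `^ (- (k%:~R * alpha)) * H)%:E)%E.
  have F0 := sphere_norm_ge0 mu r f k.
  have : ((p%:R `^ (k%:~R * alpha))%:E * sphere_norm mu r f k <= H%:E)%E.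
    rewrite /H fineK//.
    have -> : ((p%:R `^ (k%:~R * alpha))%:E * sphere_norm mu r f k =
       (((p%:R `^ (k%:~R * alpha))%:E * sphere_norm mu r f k) `^ q) `^ q^-1)%E.
      by rewrite -poweRrM mulfV ?gt_eqF// poweRe1// mule_ge0// lee_fin powR_ge0.
    apply: le_poweR; rewrite ?poweR_ge0 ?invr_ge0 ?(ltW q0)//.
    exact: (esum_term_le
      (fun k => ((p%:R `^ (k%:~R * alpha))%:E * sphere_norm mu r f k) `^ q)%E).
  rewrite -lee_pdivlMl ?powR_gt0// => HF; apply: (le_trans HF).
  by rewrite -EFinM lee_fin powRN.
pose tau := p%:R `^ ((a0 - alpha) * r).
have tau0 : 0 < tau by rewrite powR_gt0.
have tau1 : tau < 1.
  by rewrite powR_lt1_lt0// pmulr_llt0// subr_lt0.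
(* For k <= 0 the weight is 1 and the terms add up to the integral over B_0. For k > 0, [Fle] gives
   a geometric term of ratio [tau], below 1 because a0 < alpha. *)
pose G k := ((\int[mu]_(x in pball p_pr n 0 `&` psphere p_pr n k) (cmod (f x) `^ r)%:E)
   + (H `^ r)%:E * (tau ^+ `|k|%N)%:E)%E.
apply: (@le_lt_trans _ _ (\esum_(k in [set: int]) G k)%E).
  apply: le_esum => k _; rewrite /G; have [k0|k0] := leP k 0.
    rewrite mulr0 powRr0 mul1e sphere_norm_powR// setIidr; last first.
      exact: psphere_sub_pball.
    by rewrite leeDl// mule_ge0// lee_fin ?powR_ge0// exprn_ge0// ltW.
  apply: (@le_trans _ _ ((H `^ r)%:E * (tau ^+ `|k|%N)%:E)%E); last first.
    by rewrite leeDr// integral_ge0// => x _; rewrite lee_fin powR_ge0.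
  apply: (@le_trans _ _ (((p%:R `^ (a0 * k%:~R))%:E *
      (p%:R `^ (- (k%:~R * alpha)) * H)%:E) `^ r)%E).
    apply: le_poweR; rewrite ?(ltW r0)//.
      by rewrite mule_ge0 ?sphere_norm_ge0// lee_fin powR_ge0.
    by apply: lee_wpmul2l; rewrite ?lee_fin ?powR_ge0.
  rewrite -EFinM poweR_EFin lee_fin mulrA -powRD; last first.
    by apply/implyP => _; rewrite gt_eqF.
  rewrite powRM ?powR_ge0// -powRrM mulrC ler_wpM2l ?powR_ge0//.
  rewrite /tau -powR_mulrn ?powR_ge0// -powRrM le_eqVlt; apply/orP; left; apply/eqP.
  congr (_ `^ _); have -> : k%:~R = `|k|%N%:R :> R by rewrite natr_absz gtr0_norm.
  by ring.
rewrite esumD; last 2 first.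
- by move=> k _; rewrite integral_ge0// => x _; rewrite lee_fin powR_ge0.
- by move=> k _; rewrite mule_ge0// lee_fin ?powR_ge0// exprn_ge0// ltW.
rewrite -(integral_spheres mu_haar n_gt0); last 3 first.
- exact: measurable_pball.
- exact: (measurable_EFin_powR _ (measurable_pball 0) (cmeasurable_cmod mf)).
- by move=> x _; rewrite lee_fin powR_ge0.
apply: lte_add_pinfty; first exact: floc.
apply: (le_lt_trans (esum_mull_le _ _)).
- by rewrite lee_fin powR_ge0.
- by move=> k _; rewrite lee_fin exprn_ge0// ltW.
apply: (le_lt_trans (lee_wpmul2l _ (esum_int_geometric _))).
- by rewrite lee_fin powR_ge0.
- by rewrite tau0.
by rewrite -EFinM ltry.
Qed.

(** As a0 <= 0, the weight decreases with k; on the spheres inside B_K it is at least its value X at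
    K, so dividing by X bounds the integral over B_K. *)
Lemma Lr_loc_truncated_sum (a0 r : R) (g : T -> R[i]) : 0 < r -> a0 <= 0 ->
  cmeasurable g ->
  (\esum_(k in [set: int])
    ((p%:R `^ (a0 * (Num.max k 0)%:~R))%:E * sphere_norm mu r g k) `^ r < +oo)%E ->
  Lr_loc mu r g.
Proof.
move=> r0 a00 mg goo; split => // K.
set Sg := (\esum_(k in [set: int]) _)%E in goo.
have Sg0 : (0 <= Sg)%E by apply: esum_ge0 => k _; exact: poweR_ge0.
have Sfin : Sg \is a fin_num by rewrite ge0_fin_numE.
rewrite (integral_spheres mu_haar n_gt0); last 3 first.
- exact: measurable_pball.
- exact: (measurable_EFin_powR _ (measurable_pball K) (cmeasurable_cmod mg)).
- by move=> x _; rewrite lee_fin powR_ge0.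
have p1 : 1 <= (p%:R : R) by rewrite ler1n prime_gt0.
have p0 : 0 < (p%:R : R) by exact: lt_le_trans p1.
pose X := p%:R `^ (a0 * (Num.max K 0)%:~R) : R; have X0 : 0 < X by rewrite powR_gt0.
apply: (@le_lt_trans _ _ ((X^-1 `^ r)%:E * Sg)%E); last first.
  by rewrite -(fineK Sfin) -EFinM ltry.
apply: le_trans (esum_mull_le _ _); rewrite ?lee_fin ?powR_ge0//; last first.
  by move=> k _; exact: poweR_ge0.
apply: le_esum => k _; have [kK|Kk] := leP k K; last first.
  rewrite (_ : _ `&` _ = set0).
    by rewrite integral_set0 mule_ge0 ?poweR_ge0 ?lee_fin ?powR_ge0.
  apply/seteqP; split => // x [/pballE xK /psphereE[x0 xk]].
  by case: xK => [/eqP|/andP[_]]; [rewrite (negPf x0)|rewrite xk leNgt Kk].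
rewrite setIidr; last exact: psphere_sub_pball.
rewrite -sphere_norm_powR// -poweR_EFin -poweRM; last 2 first.
- by rewrite lee_fin invr_ge0 ltW.
- by rewrite mule_ge0 ?sphere_norm_ge0// lee_fin powR_ge0.
apply: le_poweR; rewrite ?(ltW r0) ?sphere_norm_ge0//.
rewrite muleA -EFinM -{1}[sphere_norm _ _ _ _]mul1e.
apply: lee_wpmul2r; rewrite ?sphere_norm_ge0// lee_fin mulrC ler_pdivlMr// mul1r.
rewrite /X ler_powR// ler_wnM2l// ler_int; lia.
Qed.

End HerzNorm.

(** * The Hardy operators *)

(** Monotonicity of max(k,0) serves the truncated weight for [hardy], the Lipschitz bound that for
    [hardy_star]. *)
Lemma maxz0_diff (j k : int) : j <= k ->
  0 <= Num.max k 0 - Num.max j 0 <= k - j.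
Proof. by lia. Qed.

Section HerzBound.
Variables (R : realType) (p : nat) (p_pr : prime p) (n : nat).
Hypothesis n_gt0 : (0 < n)%N.
Local Notation T := (padic_space p_pr n).
Variable mu : {measure set T -> \bar R}.
Hypothesis mu_haar : haar_measure mu.
Local Notation B := (pball p_pr n).
Local Notation S := (psphere p_pr n).
Local Notation V := (@pball_vol R p n).

Variables (alpha q1 q2 r r' s : R) (b : T -> R[i]).
Hypotheses (q1_gt0 : 0 < q1) (q12 : q1 <= q2).
Hypotheses (r_gt1 : 1 < r) (r'_gt1 : 1 < r') (rr' : r^-1 + r'^-1 = 1).
Hypotheses (rs : r <= s) (r's : r' <= s) (b_CMO : CMO mu s b).

Let p1 : 1 < (p%:R : R). Proof. by rewrite ltr1n prime_gt1. Qed.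
Let p0 : 0 < (p%:R : R). Proof. exact: lt_trans p1. Qed.
Let r0 : 0 < r. Proof. exact: lt_trans r_gt1. Qed.
Let q20 : 0 < q2. Proof. exact: lt_le_trans q12. Qed.

(** [commutator_weighted_le] is applied with the Herz weight and exponent q1, then with the
    truncated weight and exponent r. The passage from q1 to q2 is made on the output side. *)
Lemma kernel_commutator_herz_le (W : int -> set T) (w : int -> T -> R)
    (K : int -> int -> R) (A : (T -> R[i]) -> T -> R[i]) (a0 rho rho0 : R) :
  (forall k, measurable (W k)) -> (forall k, measurable_fun [set: T] (w k)) ->
  (forall k t, 0 <= w k t) -> (forall k j, 0 <= K k j) ->
  (forall k j t, W k t -> S j t -> w k t <= K k j) ->
  (forall f x, x != 0 ->
    cintegrable mu (W (level x)) (fun t => (w (level x) t)%:C%C * f t) ->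
    A f x = cintegral mu (W (level x)) (fun t => (w (level x) t)%:C%C * f t)) ->
  (forall f x y, x != 0 -> y != 0 -> level x = level y -> A f x = A f y) ->
  a0 < alpha -> a0 <= 0 -> 0 < rho < 1 -> 0 < rho0 < 1 ->
  (forall k j, p%:R `^ (k%:~R * alpha) * V k `^ r^-1 * K k j * V j `^ r'^-1 <=
     rho ^+ `|k - j|%N * p%:R `^ (j%:~R * alpha)) ->
  (forall k j, p%:R `^ (a0 * (Num.max k 0)%:~R) * V k `^ r^-1 * K k j * V j `^ r'^-1 <=
     rho0 ^+ `|k - j|%N * p%:R `^ (a0 * (Num.max j 0)%:~R)) ->
  exists C : R, forall f, herz mu alpha q1 r f ->
    [/\ forall k, (kernel_majorant mu b W w f k < +oo)%E,
        herz mu alpha q2 r (commutator A b f) &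
        (herz_norm mu alpha q2 r (commutator A b f) <=
           C%:E * herz_norm mu alpha q1 r f)%E].
Proof.
move=> mW mw w0 K0 wK AE Arad a0a a00 rho1 rho01 schur schur0.
have pw0 x : 0 < (p%:R `^ x : R) by rewrite powR_gt0.
have [C [C0 CP]] := commutator_weighted_le n_gt0 mu_haar r_gt1 r'_gt1 rr' rs r's
  b_CMO mW mw w0 K0 wK AE Arad (fun k => pw0 (k%:~R * alpha)) rho1 q1_gt0 schur.
have [C' [_ C'P]] := commutator_weighted_le n_gt0 mu_haar r_gt1 r'_gt1 rr' rs r's
  b_CMO mW mw w0 K0 wK AE Arad (fun k => pw0 (a0 * (Num.max k 0)%:~R)) rho01 r0 schur0.
exists (C `^ q1^-1) => f fherz; have [[mf floc] fnorm] := fherz.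
have foo := herz_sum_lty q1_gt0 r0 fnorm.
have [Too fle] := CP f mf foo.
have f0oo := herz_truncated_sum_lty n_gt0 mu_haar q1_gt0 r0 a0a fherz.
have [_ f0le] := C'P f mf f0oo.
have bound : (herz_norm mu alpha q2 r (commutator A b f) <=
    (C `^ q1^-1)%:E * herz_norm mu alpha q1 r f)%E.
  rewrite !herz_normE//.
  have u0 g k : (0 <= (p%:R `^ (k%:~R * alpha))%:E * sphere_norm mu r g k)%E.
    by rewrite mule_ge0 ?sphere_norm_ge0// lee_fin ltW.
  apply: (le_trans (esum_poweR_le q1_gt0 q12 (u0 (commutator A b f)))).
  rewrite -poweR_EFin -poweRM ?lee_fin//; last first.
    by apply: esum_ge0 => k _; exact: poweR_ge0.
  apply: le_poweR => //; first by rewrite invr_ge0 ltW.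
  by apply: esum_ge0 => k _; exact: poweR_ge0.
split; [exact: Too|split|exact: bound].
  apply: (Lr_loc_truncated_sum n_gt0 mu_haar r0 a00).
    apply: (cmeasurable_commutator b_CMO Arad).
  apply: (le_lt_trans f0le); set Sf := (\esum_(k in _) _)%E in f0oo *.
  have Sfin : Sf \is a fin_num.
    by rewrite ge0_fin_numE//; apply: esum_ge0 => k _; exact: poweR_ge0.
  by rewrite -(fineK Sfin) -EFinM ltry.
apply: (le_lt_trans bound).
have Hfin : herz_norm mu alpha q1 r f \is a fin_num.
  by rewrite ge0_fin_numE// poweR_ge0.
by rewrite -(fineK Hfin) -EFinM ltry.
Qed.

(** * Kernel data and decay for the two Hardy operators *)

Lemma pnormn_level (x : T) : x != 0 -> pnormn R x = V (level x).
Proof.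
move=> x0; rewrite /pnormn pnorm_level// fmorphXz rmorph_nat /pball_vol mulrC.
by rewrite powRrM powR_intmul ?powR_mulrn ?ler0n// exprz_ge0.
Qed.

Lemma pnormn_ge0 (x : T) : 0 <= pnormn R x.
Proof. by rewrite /pnormn exprn_ge0// ler0q pnorm_ge0. Qed.

Lemma hardy_radial f x y : x != 0 -> y != 0 -> level x = level y ->
  hardy mu f x = hardy mu f y.
Proof.
move=> x0 y0 xy; rewrite /hardy (pnormn_level x0) (pnormn_level y0).
by rewrite (pball_ofE x0) (pball_ofE y0) xy.
Qed.

Lemma hardy_star_radial f x y : x != 0 -> y != 0 -> level x = level y ->
  hardy_star mu f x = hardy_star mu f y.
Proof.
by move=> x0 y0 xy; rewrite /hardy_star (pball_ofE x0) (pball_ofE y0) xy.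
Qed.

Lemma cintegrable_unscale D (c : R) (f : T -> R[i]) : measurable D -> c != 0 ->
  cintegrable mu D (fun t => c%:C%C * f t) -> cintegrable mu D f.
Proof.
move=> mD c0 /(cintegrableZl (c%:C%C)^-1 mD).
congr cintegrable; apply/funext => t; rewrite mulrA mulVf ?mul1r//.
by rewrite eq_complex /= (negPf c0).
Qed.

Let powp0 x : 0 < (p%:R `^ x : R). Proof. by rewrite powR_gt0. Qed.
Let powpD x y : (p%:R `^ (x + y) : R) = p%:R `^ x * p%:R `^ y.
Proof. by rewrite powRD//; apply/implyP => _; rewrite gt_eqF. Qed.

(** Both sides are powers of p. As 1/r = 1 - 1/r', the exponent on the left is e k - (n/r')(k - j),
    so the hypothesis compares exponents exactly. *)
Lemma schur_inner (e : int -> R) (delta : R) :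
  (forall k j, j <= k -> e k - e j <= (n%:R / r' - delta) * (k - j)%:~R) ->
  forall k j, p%:R `^ e k * V k `^ r^-1 * (if j <= k then (V k)^-1 else 0) *
    V j `^ r'^-1 <= (p%:R `^ (- delta)) ^+ `|k - j|%N * p%:R `^ e j.
Proof.
move=> eP k j; case: (leP j k) => jk; last first.
  by rewrite mulr0 mul0r mulr_ge0 ?exprn_ge0 ?(ltW (powp0 _)).
rewrite /pball_vol -powRN -!powRrM -!powpD -powR_mulrn ?(ltW (powp0 _))//.
rewrite -powRrM -powpD ler_powR ?(ltW p1)//.
have := eP k j jk.
have -> : `|k - j|%N%:R = (k - j)%:~R :> R by rewrite natr_absz ger0_norm// subr_ge0.
have -> : r^-1 = 1 - r'^-1 by rewrite -rr' addrK.
rewrite rmorphB /=; nra.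
Qed.

(** The same comparison for j > k, where the exponent on the left is e k - (n/r)(j - k). *)
Lemma schur_outer (e : int -> R) (delta : R) :
  (forall k j, k < j -> e k - e j <= (n%:R / r - delta) * (j - k)%:~R) ->
  forall k j, p%:R `^ e k * V k `^ r^-1 * (if k < j then (V j)^-1 else 0) *
    V j `^ r'^-1 <= (p%:R `^ (- delta)) ^+ `|k - j|%N * p%:R `^ e j.
Proof.
move=> eP k j; case: (ltP k j) => jk; last first.
  by rewrite mulr0 mul0r mulr_ge0 ?exprn_ge0 ?(ltW (powp0 _)).
rewrite /pball_vol -powRN -!powRrM -!powpD -powR_mulrn ?(ltW (powp0 _))//.
rewrite -powRrM -powpD ler_powR ?(ltW p1)//.
have := eP k j jk.
have -> : `|k - j|%N%:R = (j - k)%:~R :> R.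
  by rewrite natr_absz -normrN opprB gtr0_norm// subr_gt0.
have -> : r'^-1 = 1 - r^-1 by rewrite -rr' addrC addKr.
rewrite rmorphB /=; nra.
Qed.

Let powp_lt1 x : 0 < x -> 0 < p%:R `^ (- x) < (1 : R).
Proof. by move=> x0; rewrite powp0 powR_lt1_lt0 ?oppr_lt0. Qed.

Lemma hardy_commutator_bounded : alpha < n%:R / r' ->
  herz_bounded mu alpha q1 q2 r
    (commutator_defined (hardy_defined mu) b) (commutator (hardy mu) b).
Proof.
move=> alt; pose w k (_ : T) := (V k)^-1.
have V0 k : 0 < V k by exact: pball_vol_gt0.
have Vi0 k : 0 <= (V k)^-1 by rewrite invr_ge0 ltW.
have nr'0 : 0 < n%:R / r' :> R.
  by rewrite divr_gt0 ?ltr0n// (lt_trans _ r'_gt1).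
(* Any a0 below alpha and not above 0 serves: the truncated weight is then nonincreasing, and for j
   <= k the full decay delta = n/r' remains. *)
pose a0 := Num.min alpha 0 - 1.
have a0a : a0 < alpha.
  by rewrite ltrBlDr (le_lt_trans (_ : _ <= alpha)) ?ltrDl// ge_min lexx.
have a00 : a0 <= 0.
  by rewrite lerBlDr (le_trans (_ : _ <= 0)) ?ge_min ?lexx ?orbT// add0r ler01.
have unscale k f : cintegrable mu (B k) (fun t => (w k t)%:C%C * f t) ->
    cintegrable mu (B k) f.
  by apply: cintegrable_unscale; rewrite ?invr_eq0 ?gt_eqF//; exact: measurable_pball.
have mW k : measurable (B k) := measurable_pball k.
have mw k : measurable_fun [set: T] (w k) by exact: measurable_cst.
pose K k j := if j <= k then (V k)^-1 else 0.
have K0 k j : 0 <= K k j by rewrite /K; case: ifP.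
have wK k j (t : T) : B k t -> S j t -> w k t <= K k j.
  move=> /pballE tk /psphereE[t0 tj]; rewrite /K -tj.
  by case: tk => [/eqP|/andP[_ ->]//]; rewrite (negPf t0).
have AE f x : x != 0 ->
    cintegrable mu (B (level x)) (fun t => (w (level x) t)%:C%C * f t) ->
    hardy mu f x = cintegral mu (B (level x)) (fun t => (w (level x) t)%:C%C * f t).
  move=> x0 /unscale fi; rewrite /hardy (pnormn_level x0) (pball_ofE x0).
  exact: (esym (cintegralZl _ (mW _) fi)).
have rho1 : 0 < p%:R `^ (- (n%:R / r' - alpha)) < (1 : R).
  by apply: powp_lt1; rewrite subr_gt0.
(* With delta = n/r' - alpha the condition on the Herz weight is an equality, and alpha < n/r' says
   that delta is positive. *)
have sch := schur_inner (e := fun k => k%:~R * alpha) (delta := n%:R / r' - alpha).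
have sch0 := schur_inner (e := fun k => a0 * (Num.max k 0)%:~R) (delta := n%:R / r').
have H k j : j <= k -> k%:~R * alpha - j%:~R * alpha <=
    (n%:R / r' - (n%:R / r' - alpha)) * (k - j)%:~R.
  by move=> _; rewrite subKr rmorphB /= -mulrBl mulrC.
have H0 k j : j <= k ->
    a0 * (Num.max k 0)%:~R - a0 * (Num.max j 0)%:~R <=
    (n%:R / r' - n%:R / r') * (k - j)%:~R.
  move=> jk; rewrite subrr mul0r -mulrBr -rmorphB/=.
  by have /andP[m0 _] := maxz0_diff jk; rewrite mulr_le0_ge0 ?a00// ler0z.
have [C CP] := kernel_commutator_herz_le mW mw (fun k _ => Vi0 k) K0 wK AE
  (@hardy_radial) a0a a00 rho1 (powp_lt1 nr'0) (sch H) (sch0 H0).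
exists C => f fh; have [Too Ah Ale] := CP f fh; split => //.
have [[mf _] _] := fh.
have ki k := kernel_integrable b_CMO mW mw (fun k _ => Vi0 k) mf (Too k).
split=> x x0; rewrite (pball_ofE x0); have [i1 _ i3] := ki (level x).
  exact: unscale i1.
exact: unscale i3.
Qed.

Lemma hardy_star_commutator_bounded : - (n%:R / r) < alpha ->
  herz_bounded mu alpha q1 q2 r
    (commutator_defined (hardy_star_defined mu) b) (commutator (hardy_star mu) b).
Proof.
move=> alt; pose w (_ : int) (t : T) := (pnormn R t)^-1.
have V0 k : 0 < V k by exact: pball_vol_gt0.
have Vi0 k : 0 <= (V k)^-1 by rewrite invr_ge0 ltW.
have nr0 : 0 < n%:R / r :> R by rewrite divr_gt0 ?ltr0n.
(* The midpoint of -n/r and min(alpha, 0). A decreasing weight now works against the kernel, so a0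
   must stay above -n/r for the decay n/r + a0 to be positive. *)
pose a0 := (Num.min alpha 0 - n%:R / r) / 2.
have min0 : Num.min alpha 0 <= 0 by rewrite ge_min lexx orbT.
have mina : Num.min alpha 0 <= alpha by rewrite ge_min lexx.
have minr : - (n%:R / r) < Num.min alpha 0 by rewrite lt_min alt oppr_lt0.
have a0a : a0 < alpha by rewrite /a0; lra.
have a00 : a0 <= 0 by rewrite /a0; lra.
have nra0 : 0 < n%:R / r + a0 by rewrite /a0; lra.
have mW k : measurable (~` B k) by apply: measurableC; exact: measurable_pball.
have mw k : measurable_fun [set: T] (w k).
  apply: measurable_radial => x y x0 y0 xy.
  by rewrite /w (pnormn_level x0) (pnormn_level y0) xy.
have w0 k t : 0 <= w k t by rewrite invr_ge0 pnormn_ge0.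
pose K k j := if k < j then (V j)^-1 else 0.
have K0 k j : 0 <= K k j by rewrite /K; case: ifP.
have wK k j (t : T) : (~` B k) t -> S j t -> w k t <= K k j.
  move=> tk /psphereE[t0 tj]; rewrite /K /w (pnormn_level t0) tj.
  case: ltP => // jk; exfalso; apply: tk; apply/pballE; right.
  by rewrite t0 tj.
have wE k (f : T -> R[i]) :
    (fun t => f t / (pnormn R t)%:C%C) = (fun t => (w k t)%:C%C * f t).
  by apply/funext => t; rewrite mulrC /w fmorphV.
have AE f x : x != 0 ->
    cintegrable mu (~` B (level x)) (fun t => (w (level x) t)%:C%C * f t) ->
    hardy_star mu f x =
      cintegral mu (~` B (level x)) (fun t => (w (level x) t)%:C%C * f t).
  by move=> x0 _; rewrite /hardy_star (pball_ofE x0) (wE (level x)).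
have rho1 : 0 < p%:R `^ (- (n%:R / r + alpha)) < (1 : R).
  by apply: powp_lt1; rewrite -ltrBlDl sub0r.
have sch := schur_outer (e := fun k => k%:~R * alpha) (delta := n%:R / r + alpha).
have sch0 := schur_outer (e := fun k => a0 * (Num.max k 0)%:~R) (delta := n%:R / r + a0).
have H k j : k < j -> k%:~R * alpha - j%:~R * alpha <=
    (n%:R / r - (n%:R / r + alpha)) * (j - k)%:~R.
  by move=> _; rewrite rmorphB /= le_eqVlt; apply/orP; left; apply/eqP; ring.
have H0 k j : k < j ->
    a0 * (Num.max k 0)%:~R - a0 * (Num.max j 0)%:~R <=
    (n%:R / r - (n%:R / r + a0)) * (j - k)%:~R.
  move=> kj; have -> : (n%:R / r - (n%:R / r + a0)) * (j - k)%:~R = a0 * (k - j)%:~R.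
    by rewrite !rmorphB /=; ring.
  have /andP[_] := maxz0_diff (ltW kj); rewrite -lerN2 !opprB => m0.
  by rewrite -mulrBr -rmorphB/= ler_wnM2l ?a00// ler_int.
have [C CP] := kernel_commutator_herz_le mW mw w0 K0 wK AE
  (@hardy_star_radial) a0a a00 rho1 (powp_lt1 nra0) (sch H) (sch0 H0).
exists C => f fh; have [Too Ah Ale] := CP f fh; split => //.
have [[mf _] _] := fh.
have ki k := kernel_integrable b_CMO mW mw w0 mf (Too k).
split=> x x0; rewrite (pball_ofE x0) (wE (level x)); have [i1 _ i3] := ki (level x).
  exact: i1.
exact: i3.
Qed.

End HerzBound.


Theorem theorem3p1 (R : realType) (p : nat) (p_pr : prime p)
  (n : nat) (n_ge1 : (1 <= n)%N)
  (mu : {measure set (padic_space p_pr n) -> \bar R})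
  (mu_haar : haar_measure mu)
  (alpha q1 q2 r r' : R)
  (q1_gt0 : 0 < q1) (q1_le_q2 : q1 <= q2) (r_gt1 : 1 < r)
  (rr' : r^-1 + r'^-1 = 1)
  (b : padic_space p_pr n -> R[i]) (b_CMO : CMO mu (Num.max r' r) b) :
  (alpha < n%:R / r' ->
     herz_bounded mu alpha q1 q2 r
       (commutator_defined (hardy_defined mu) b) (commutator (hardy mu) b)) /\
  (- (n%:R / r) < alpha ->
     herz_bounded mu alpha q1 q2 r
       (commutator_defined (hardy_star_defined mu) b)
       (commutator (hardy_star mu) b)).
Proof.
have r0 : 0 < r := lt_trans ltr01 r_gt1.
have ri : 0 < r^-1 < 1 by rewrite invr_gt0 r0 invf_lt1.
have r'E : r'^-1 = 1 - r^-1 by rewrite -rr' addrC addKr.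
(* 1/r' = 1 - 1/r lies strictly between 0 and 1, which excludes negative r' as well as r' = 0, whose
   inverse is 0 by convention. *)
have r'0 : 0 < r' by rewrite -invr_gt0 r'E subr_gt0; case/andP: ri.
have r'_gt1 : 1 < r'.
  by rewrite -invf_lt1// r'E ltrBlDr ltrDl; case/andP: ri.
have rs : r <= Num.max r' r by rewrite le_max lexx orbT.
have r's : r' <= Num.max r' r by rewrite le_max lexx.
split.
- exact: (hardy_commutator_bounded n_ge1 mu_haar q1_gt0 q1_le_q2 r_gt1 r'_gt1 rr'
    rs r's b_CMO).
- exact: (hardy_star_commutator_bounded n_ge1 mu_haar q1_gt0 q1_le_q2 r_gt1 r'_gt1
    rr' rs r's b_CMO).
Qed.
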